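(* Let $\mathsf{Bun}:\mathcal{C}^{\mathrm{op}}\to\mathbf{Cat}$ be an indexed category and let $T$ be a section of its Grothendieck construction. Let $\binom{u}{\mathsf{id}}:\binom{TS}{S}\leftrightarrows\binom{I}{S}$ be a $(\mathsf{Bun},T)$-dynamical system which exposes its entire state (its output object is its state object $S$ and its readout is $\mathsf{id}_S$, so that $I\in\mathsf{Bun}(S)$ and $u:I\to TS$ in $\mathsf{Bun}(S)$). Then there is an indexed double functor covariantly represented by $\binom{u}{\mathsf{id}}$, $$\Big(\textstyle\int\mathsf{Bun}\big(\binom{I}{S},-\big),\; h\mathsf{Dyn}\big(\binom{u}{\mathsf{id}},-\big)\Big):\ \big(\mathsf{Interface},\mathsf{Dyn}\big)\longrightarrow\big(\mathsf{Span}(\mathbf{Set}),\mathbf{Set}_{/(-)}\big),$$ that is, a double functor $\int\mathsf{Bun}\big(\binom{I}{S},-\big):\mathsf{Interface}\to\mathsf{Span}(\mathbf{Set})$ together with a transformation $$h\mathsf{Dyn}\big(\tbinom{u}{\mathsf{id}},-\big):\mathsf{Dyn}\Rightarrow\mathbf{Set}_{/(-)}\circ\textstyle\int\mathsf{Bun}\big(\binom{I}{S},-\big)$$ of $\mathbf{Cat}$-valued lax double functors on $\mathsf{Interface}$, given as follows. (1) The double functor $\int\mathsf{Bun}\big(\binom{I}{S},-\big)$ sends an object $\binom{I'}{O'}$ to the hom-set of bundle maps $\int\mathsf{Bun}\big(\binom{I}{S},\binom{I'}{O'}\big)$. It acts on horizontal morphisms by post-composition. It sends a lens $\binom{f^\sharp}{f}:\binom{I'}{O'}\leftrightarrows\binom{I''}{O''}$,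 regarded as the span $\binom{I'}{O'}\xleftarrow{\binom{f^\sharp}{\mathsf{id}}}\binom{f^*I''}{O'}\xrightarrow{\binom{\mathsf{id}}{f}}\binom{I''}{O''}$ in $\int\mathsf{Bun}$, to the span of sets obtained by applying the representable functor $\int\mathsf{Bun}\big(\binom{I}{S},-\big)$. It acts likewise on squares, regarded as maps of spans in $\int\mathsf{Bun}$. (2) For each interface $\binom{I'}{O'}$, the component of the transformation is the functor $$\mathsf{Dyn}\tbinom{I'}{O'}\to\mathbf{Set}_{/\int\mathsf{Bun}\left(\binom{I}{S},\binom{I'}{O'}\right)}$$ sending a dynamical system $\binom{u'}{r'}$ to the set $h\mathsf{Dyn}\big(\binom{u}{\mathsf{id}},\binom{u'}{r'}\big)$ of covariant morphisms, equipped with its projection to the underlying bundle map in $\int\mathsf{Bun}\big(\binom{I}{S},\binom{I'}{O'}\big)$, and acting on morphisms by composition. (3) For each bundle map $\binom{g_\sharp}{g}:\binom{I'}{O'}\rightrightarrows\binom{I''}{O''}$, the component is the map of profunctors which sends a covariant morphism from $\binom{u'}{r'}$ to $\binom{u''}{r''}$ over $\binom{g_\sharp}{g}$ with state map $\varphi:S'\to S''$ to the commuting square of sets whose top is post-composition with that covariant morphism, $h\mathsf{Dyn}\big(\binom{u}{\mathsf{id}},\binom{u'}{r'}\big)\to h\mathsf{Dyn}\big(\binom{u}{\mathsf{id}},\binom{u''}{r''}\big)$, and whose bottom is post-composition with $\binom{g_\sharp}{g}$.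
   Context: **Indexed categories and sections.** An indexed category $\mathsf{Bun}:\mathcal{C}^{\mathrm{op}}\to\mathbf{Cat}$ assigns to each $C\in\mathcal{C}$ a category $\mathsf{Bun}(C)$ and to each $f:C\to C'$ a functor $f^*:\mathsf{Bun}(C')\to\mathsf{Bun}(C)$, functorially (canonical coherence isomorphisms such as $f^*g^*\cong(gf)^*$ are written as equalities). Its Grothendieck construction $\int\mathsf{Bun}$ has as objects pairs $\binom{A}{C}$ with $C\in\mathcal{C}$, $A\in\mathsf{Bun}(C)$, and as morphisms (bundle maps) $\binom{g_\sharp}{g}:\binom{A}{C}\rightrightarrows\binom{A'}{C'}$ pairs $g:C\to C'$, $g_\sharp:A\to g^*A'$. A section $T$ is a functor $T:\mathcal{C}\to\int\mathsf{Bun}$ splitting the projection $\int\mathsf{Bun}\to\mathcal{C}$. Write $T(S)=\binom{TS}{S}$ with $TS\in\mathsf{Bun}(S)$, and $T(\varphi)=\binom{T\varphi}{\varphi}$ with $T\varphi:TS\to\varphi^*TS'$ for $\varphi:S\to S'$. **Lenses.** A $\mathsf{Bun}$-lens $\binom{f^\sharp}{f}:\binom{A}{C}\leftrightarrows\binom{A'}{C'}$ is a pair $f:C\to C'$, $f^\sharp:f^*A'\to A$, i.e. a morphism in the Grothendieck construction of the pointwise opposite $C\mapsto\mathsf{Bun}(C)^{\mathrm{op}}$, composed accordingly. **The double category $\mathsf{Interface}$.** Objects are pairs $\binom{A}{C}$ with $C\in\mathcal{C}$ and $A\in\mathsf{Bun}(C)$. Vertical morphisms are $\mathsf{Bun}$-lenses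 and horizontal morphisms are bundle maps. There is a (unique) square with top $\binom{g_{1\sharp}}{g_1}:\binom{A_1}{C_1}\rightrightarrows\binom{A_2}{C_2}$, bottom $\binom{g_{2\sharp}}{g_2}:\binom{A_3}{C_3}\rightrightarrows\binom{A_4}{C_4}$, left $\binom{f_1^\sharp}{f_1}:\binom{A_1}{C_1}\leftrightarrows\binom{A_3}{C_3}$ and right $\binom{f_2^\sharp}{f_2}:\binom{A_2}{C_2}\leftrightarrows\binom{A_4}{C_4}$ if and only if $f_2g_1=g_2f_1$ and $g_{1\sharp}\circ f_1^\sharp=(g_1^*f_2^\sharp)\circ(f_1^*g_{2\sharp})$ as maps $f_1^*A_3\to g_1^*A_2$ (using $f_1^*g_2^*A_4=g_1^*f_2^*A_4$). Equivalently, up to equivalence of double categories, a lens is a span $\binom{A}{C}\xleftarrow{\binom{f^\sharp}{\mathsf{id}}}\binom{f^*A'}{C}\xrightarrow{\binom{\mathsf{id}}{f}}\binom{A'}{C'}$ in $\int\mathsf{Bun}$ with vertical left leg and cartesian right leg, composed by pullback, and a square is a map of such spans. **Dynamical systems.** A $(\mathsf{Bun},T)$-dynamical system with interface $\binom{I}{O}$ is a lens $\binom{u}{r}:\binom{TS}{S}\leftrightarrows\binom{I}{O}$, i.e. a state object $S\in\mathcal{C}$, an output object $O\in\mathcal{C}$, an input bundle $I\in\mathsf{Bun}(O)$, a readout $r:S\to O$ and an update $u:r^*I\to TS$ in $\mathsf{Bun}(S)$. A covariant morphism from $\binom{u}{r}:\binom{TS}{S}\leftrightarrows\binom{I}{O}$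 to $\binom{u'}{r'}:\binom{TS'}{S'}\leftrightarrows\binom{I'}{O'}$ over a bundle map $\binom{g_\sharp}{g}:\binom{I}{O}\rightrightarrows\binom{I'}{O'}$ is a map $\varphi:S\to S'$ such that there is a square in $\mathsf{Interface}$ with top $\binom{T\varphi}{\varphi}$, bottom $\binom{g_\sharp}{g}$, left $\binom{u}{r}$ and right $\binom{u'}{r'}$. The set $h\mathsf{Dyn}\big(\binom{u}{r},\binom{u'}{r'}\big)$ consists of all pairs of a bundle map $\binom{g_\sharp}{g}$ and a covariant morphism over it. Covariant morphisms compose by horizontal composition of squares. **Indexed double categories.** An indexed double category is a lax double functor $E:\mathcal{D}\to\mathbf{Cat}$ from a double category $\mathcal{D}$ to the double category $\mathbf{Cat}$ of categories, functors (vertical) and profunctors (horizontal). It is lax in the horizontal direction, with laxators $E(g)\otimes E(g')\to E(g'\circ g)$ and unitors, and (pseudo)functorial in the vertical direction. **The indexed double category $\mathsf{Dyn}:\mathsf{Interface}\to\mathbf{Cat}$.** $\mathsf{Dyn}\binom{I}{O}$ is the category of dynamical systems with interface $\binom{I}{O}$ and covariant morphisms over the identity of $\binom{I}{O}$. A lens $\binom{f^\sharp}{f}:\binom{I}{O}\leftrightarrows\binom{I'}{O'}$ is sent to the functor $\mathsf{Dyn}\binom{I}{O}\to\mathsf{Dyn}\binom{I'}{O'}$ of vertical composition with it. A bundle map $\binom{g_\sharp}{g}$ is sent to the profunctor sending $\big(\binom{u}{r},\binom{u'}{r'}\big)$ to the set of covariant morphisms from $\binom{u}{r}$ to $\binom{u'}{r'}$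 over $\binom{g_\sharp}{g}$, with actions by horizontal composition. The laxator and unitor are given by horizontal composition and identities. A square of $\mathsf{Interface}$ is sent to the morphism of profunctors given by vertical composition with it. **The slice indexed double category $\mathcal{A}_{/(-)}:\mathsf{Span}(\mathcal{A})\to\mathbf{Cat}$**, for a category $\mathcal{A}$ with finite limits (here $\mathcal{A}=\mathbf{Set}$). $\mathsf{Span}(\mathcal{A})$ is the double category with objects those of $\mathcal{A}$, vertical morphisms the spans in $\mathcal{A}$ (composed by pullback), horizontal morphisms the maps of $\mathcal{A}$, and squares the maps of spans. The indexed double category sends an object $X$ to the slice category $\mathcal{A}_{/X}$, and a span $X\xleftarrow{f}Z\xrightarrow{g}Y$ to the functor $g_!f^*:\mathcal{A}_{/X}\to\mathcal{A}_{/Y}$ (pull back along $f$, then compose with $g$). It sends a map $f:X\to Y$ to the profunctor $(\mathcal{A}_{/X})^{\mathrm{op}}\times\mathcal{A}_{/Y}\to\mathbf{Set}$ assigning to $x:Z_1\to X$ and $y:Z_2\to Y$ the set of maps $k:Z_1\to Z_2$ with $yk=fx$, acted on by composition. It sends a map of spans, from $X_1\leftarrow Z_1\to Y_1$ to $X_2\leftarrow Z_2\to Y_2$, to the morphism of profunctors obtained by pulling back along the square over $X_1\to X_2$ and pushing forward along the square over $Y_1\to Y_2$. **Indexed double functors.** An indexed double functor $(K,\alpha):(\mathcal{D},E)\to(\mathcal{D}',E')$ consists of a double functor $K:\mathcal{D}\to\mathcal{D}'$ (preserving vertical composition up to coherent isomorphism) and a transformation $\alpha:E\Rightarrow E'\circ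 K$, i.e.: (i) a functor $\alpha_D:E(D)\to E'(KD)$ for each object $D$; (ii) for each vertical $f:D\to D_1$, a natural isomorphism $E'(Kf)\circ\alpha_D\cong\alpha_{D_1}\circ E(f)$, coherent with vertical identities and composites; (iii) for each horizontal $g$ from $D$ to $D_1$, a map of profunctors $\alpha_g:E(g)(A,A_1)\to E'(Kg)(\alpha_DA,\alpha_{D_1}A_1)$, natural in $A,A_1$ and compatible with laxators and unitors; (iv) for each square $\sigma$ of $\mathcal{D}$ with top $g$ and bottom $g'$, the maps $\alpha_g,\alpha_{g'}$ commute with $E(\sigma)$ and $E'(K\sigma)$ modulo the isomorphisms of (ii). *)

(* Defs.v *)
From Stdlib Require Import ssreflect FunctionalExtensionality ProofIrrelevance.

Set Implicit Arguments.
Unset Strict Implicit.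
Unset Printing Implicit Defensive.

#[local] Obligation Tactic := idtac.

Record category := Category {
  ob :> Type;
  hom : ob -> ob -> Type;
  idm : forall a, hom a a;
  comp : forall a b c, hom b c -> hom a b -> hom a c;
  comp_idl : forall a b (f : hom a b), comp (idm b) f = f;
  comp_idr : forall a b (f : hom a b), comp f (idm a) = f;
  comp_assoc : forall a b c d (h : hom c d) (g : hom b c) (f : hom a b),
    comp h (comp g f) = comp (comp h g) f
}.
Arguments idm {C} a : rename.
Arguments comp {C a b c} _ _ : rename.
Notation "g ∘ f" := (comp g f) (at level 40, left associativity).

Record iso (C : category) (a b : C) := Iso {
  iso_to : hom a b;
  iso_from : hom b a;
  iso_fromK : iso_from ∘ iso_to = idm a;
  iso_toK : iso_to ∘ iso_from = idm b
}.

Definition eq_hom (C : category) (a b : C) (e : a = b) : hom a b :=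
  match e in _ = c return hom a c with eq_refl => idm a end.

Record functor (C D : category) := Functor {
  fob :> C -> D;
  fmap : forall a b, hom a b -> hom (fob a) (fob b);
  fmap_id : forall a, fmap (idm a) = idm (fob a);
  fmap_comp : forall a b c (g : hom b c) (f : hom a b),
    fmap (g ∘ f) = fmap g ∘ fmap f
}.
Arguments fmap {C D} _ {a b} _.

(** A profunctor [C^op * D -> Set], presented by its two commuting actions. *)
Record profunctor (C D : category) := Profunctor {
  pob :> C -> D -> Type;
  lact : forall a' a b, hom a' a -> pob a b -> pob a' b;
  ract : forall a b b', hom b b' -> pob a b -> pob a b';
  lact_id : forall a b (p : pob a b), lact (idm a) p = p;
  lact_comp : forall a'' a' a b (f : hom a' a) (f' : hom a'' a') (p : pob a b),
    lact (f ∘ f') p = lact f' (lact f p);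
  ract_id : forall a b (p : pob a b), ract (idm b) p = p;
  ract_comp : forall a b b' b'' (g' : hom b' b'') (g : hom b b') (p : pob a b),
    ract (g' ∘ g) p = ract g' (ract g p);
  lact_ract : forall a' a b b' (f : hom a' a) (g : hom b b') (p : pob a b),
    lact f (ract g p) = ract g (lact f p)
}.
Arguments lact {C D P a' a b} _ _ : rename.
Arguments ract {C D P a b b'} _ _ : rename.

Definition Sets : category :=
  @Category Type (fun A B => A -> B) (fun A x => x) (fun A B C g f x => g (f x))
    (fun A B f => eq_refl) (fun A B f => eq_refl) (fun A B C D h g f => eq_refl).

Program Definition representable (C : category) (a : C) : functor C Sets :=
  @Functor C Sets (fun b => hom a b) (fun b c g f => g ∘ f) _ _.
Next Obligation. by move=> *; apply: functional_extensionality => f; apply: comp_idl. Qed.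
Next Obligation.
by move=> *; apply: functional_extensionality => h; rewrite /= comp_assoc.
Qed.

(** A pseudo double category. Horizontal composition is strict and vertical composition is weak.  Two
    squares whose horizontal boundaries are equal but perhaps not convertible
    are compared in the type of all squares between given vertical morphisms,
    i.e. as morphisms in the category of vertical morphisms and squares. *)

Record double_data := DoubleData {
  hcat :> category;
  vhom : hcat -> hcat -> Type;
  vid : forall A, vhom A A;
  vcomp : forall A B C, vhom B C -> vhom A B -> vhom A C;
  sq : forall A B C D, hom A B -> hom C D -> vhom A C -> vhom B D -> Type;
  sq_hid : forall A C (v : vhom A C), sq (idm A) (idm C) v v;
  sq_hcomp : forall A0 A1 A2 C0 C1 C2
    (t' : hom A1 A2) (b' : hom C1 C2) (t : hom A0 A1) (b : hom C0 C1)
    (l : vhom A0 C0) (m : vhom A1 C1) (r : vhom A2 C2),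
    sq t' b' m r -> sq t b l m -> sq (t' ∘ t) (b' ∘ b) l r;
  sq_vid : forall A B (t : hom A B), sq t t (vid A) (vid B);
  sq_vcomp : forall A0 A1 B0 B1 C0 C1
    (t : hom A0 A1) (m : hom B0 B1) (b : hom C0 C1)
    (l' : vhom B0 C0) (r' : vhom B1 C1) (l : vhom A0 B0) (r : vhom A1 B1),
    sq m b l' r' -> sq t m l r -> sq t b (vcomp l' l) (vcomp r' r)
}.
Arguments vhom {d} _ _.
Arguments vid {d} A.
Arguments vcomp {d A B C} _ _.
Arguments sq {d A B C D} _ _ _ _.
Arguments sq_hid {d A C} v.
Arguments sq_hcomp {d A0 A1 A2 C0 C1 C2 t' b' t b l m r} _ _.
Arguments sq_vid {d A B} t.
Arguments sq_vcomp {d A0 A1 B0 B1 C0 C1 t m b l' r' l r} _ _.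

Definition sq_total (D : double_data) (A B A' B' : D) (l : vhom A A')
    (r : vhom B B') (t : hom A B) (b : hom A' B') (s : sq t b l r) :
    {t : hom A B & {b : hom A' B' & sq t b l r}} :=
  existT _ t (existT _ b s).

Notation "s ≡ s'" := (sq_total s = sq_total s') (at level 70, no associativity).

(** A globular square (trivial top and bottom) that is invertible for
    horizontal composition. *)
Record globular_iso (D : double_data) (A C : D) (v w : vhom A C) := GlobularIso {
  glob_to :> sq (idm A) (idm C) v w;
  glob_from : sq (idm A) (idm C) w v;
  glob_fromK : sq_hcomp glob_from glob_to ≡ sq_hid v;
  glob_toK : sq_hcomp glob_to glob_from ≡ sq_hid w
}.

Record double_category := DoubleCategory {
  double_data_of :> double_data;
  sq_hcomp_idl : forall (A B A' B' : double_data_of) (l : vhom A A')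
    (r : vhom B B') (t : hom A B) (b : hom A' B') (s : sq t b l r),
    sq_hcomp (sq_hid r) s ≡ s;
  sq_hcomp_idr : forall (A B A' B' : double_data_of) (l : vhom A A')
    (r : vhom B B') (t : hom A B) (b : hom A' B') (s : sq t b l r),
    sq_hcomp s (sq_hid l) ≡ s;
  sq_hcomp_assoc : forall (A0 A1 A2 A3 C0 C1 C2 C3 : double_data_of)
    (t'' : hom A2 A3) (b'' : hom C2 C3) (t' : hom A1 A2) (b' : hom C1 C2)
    (t : hom A0 A1) (b : hom C0 C1)
    (v0 : vhom A0 C0) (v1 : vhom A1 C1) (v2 : vhom A2 C2) (v3 : vhom A3 C3)
    (s'' : sq t'' b'' v2 v3) (s' : sq t' b' v1 v2) (s : sq t b v0 v1),
    sq_hcomp s'' (sq_hcomp s' s) ≡ sq_hcomp (sq_hcomp s'' s') s;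
  sq_vid_id : forall A : double_data_of, sq_vid (idm A) = sq_hid (vid A);
  sq_vid_comp : forall (A B C : double_data_of) (g : hom B C) (f : hom A B),
    sq_vid (g ∘ f) = sq_hcomp (sq_vid g) (sq_vid f);
  sq_vcomp_hid : forall (A B C : double_data_of) (w : vhom B C) (v : vhom A B),
    sq_vcomp (sq_hid w) (sq_hid v) = sq_hid (vcomp w v);
  sq_interchange : forall (A0 A1 A2 B0 B1 B2 C0 C1 C2 : double_data_of)
    (t : hom A0 A1) (m : hom B0 B1) (b : hom C0 C1)
    (t' : hom A1 A2) (m' : hom B1 B2) (b' : hom C1 C2)
    (v0 : vhom A0 B0) (v1 : vhom A1 B1) (v2 : vhom A2 B2)
    (w0 : vhom B0 C0) (w1 : vhom B1 C1) (w2 : vhom B2 C2)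
    (z' : sq m' b' w1 w2) (z : sq m b w0 w1)
    (s' : sq t' m' v1 v2) (s : sq t m v0 v1),
    sq_vcomp (sq_hcomp z' z) (sq_hcomp s' s)
      = sq_hcomp (sq_vcomp z' s') (sq_vcomp z s);
  vassoc : forall (A B C D : double_data_of)
    (h : vhom C D) (g : vhom B C) (f : vhom A B),
    globular_iso (vcomp h (vcomp g f)) (vcomp (vcomp h g) f);
  vunitl : forall (A B : double_data_of) (f : vhom A B),
    globular_iso (vcomp (vid B) f) f;
  vunitr : forall (A B : double_data_of) (f : vhom A B),
    globular_iso (vcomp f (vid A)) f;
  vassoc_natural : forall (A B C D A' B' C' D' : double_data_of)
    (a : hom A A') (b : hom B B') (c : hom C C') (d : hom D D')
    (f : vhom A B) (g : vhom B C) (h : vhom C D)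
    (f' : vhom A' B') (g' : vhom B' C') (h' : vhom C' D')
    (z : sq c d h h') (y : sq b c g g') (x : sq a b f f'),
    sq_hcomp (vassoc h' g' f') (sq_vcomp z (sq_vcomp y x))
      ≡ sq_hcomp (sq_vcomp (sq_vcomp z y) x) (vassoc h g f);
  vunitl_natural : forall (A B A' B' : double_data_of) (a : hom A A')
    (b : hom B B') (f : vhom A B) (f' : vhom A' B') (x : sq a b f f'),
    sq_hcomp (vunitl f') (sq_vcomp (sq_vid b) x) ≡ sq_hcomp x (vunitl f);
  vunitr_natural : forall (A B A' B' : double_data_of) (a : hom A A')
    (b : hom B B') (f : vhom A B) (f' : vhom A' B') (x : sq a b f f'),
    sq_hcomp (vunitr f') (sq_vcomp x (sq_vid a)) ≡ sq_hcomp x (vunitr f);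
  vpentagon : forall (A B C D E : double_data_of)
    (k : vhom D E) (h : vhom C D) (g : vhom B C) (f : vhom A B),
    sq_hcomp (vassoc (vcomp k h) g f) (vassoc k h (vcomp g f))
      ≡ sq_hcomp (sq_vcomp (vassoc k h g) (sq_hid f))
          (sq_hcomp (vassoc k (vcomp h g) f)
             (sq_vcomp (sq_hid k) (vassoc h g f)));
  vtriangle : forall (A B C : double_data_of) (g : vhom B C) (f : vhom A B),
    sq_hcomp (sq_vcomp (vunitr g) (sq_hid f)) (vassoc g (vid B) f)
      ≡ sq_vcomp (sq_hid g) (vunitl f)
}.
Arguments vassoc {D A B C E} h g f : rename.
Arguments vunitl {D A B} f : rename.
Arguments vunitr {D A B} f : rename.

(** Double functors are strict horizontally and pseudo vertically. *)

Record double_functor_data (D D' : double_data) := DoubleFunctorData {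
  df_ob :> D -> D';
  df_hor : forall A B : D, hom A B -> hom (df_ob A) (df_ob B);
  df_ver : forall A B : D, vhom A B -> vhom (df_ob A) (df_ob B);
  df_sq : forall (A B A' B' : D) (t : hom A B) (b : hom A' B')
    (l : vhom A A') (r : vhom B B'),
    sq t b l r -> sq (df_hor t) (df_hor b) (df_ver l) (df_ver r)
}.
Arguments df_hor {D D'} _ {A B} _.
Arguments df_ver {D D'} _ {A B} _.
Arguments df_sq {D D'} _ {A B A' B' t b l r} _.

Record double_functor (D D' : double_category) := DoubleFunctor {
  df_data :> double_functor_data D D';
  df_hor_id : forall A : D, df_hor df_data (idm A) = idm (df_data A);
  df_hor_comp : forall (A B C : D) (g : hom B C) (f : hom A B),
    df_hor df_data (g ∘ f) = df_hor df_data g ∘ df_hor df_data f;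
  df_sq_hid : forall (A B : D) (v : vhom A B),
    df_sq df_data (sq_hid v) ≡ sq_hid (df_ver df_data v);
  df_sq_hcomp : forall (A0 A1 A2 C0 C1 C2 : D)
    (t' : hom A1 A2) (b' : hom C1 C2) (t : hom A0 A1) (b : hom C0 C1)
    (l : vhom A0 C0) (m : vhom A1 C1) (r : vhom A2 C2)
    (s' : sq t' b' m r) (s : sq t b l m),
    df_sq df_data (sq_hcomp s' s)
      ≡ sq_hcomp (df_sq df_data s') (df_sq df_data s);
  df_vid : forall A : D,
    globular_iso (vid (df_data A)) (df_ver df_data (vid A));
  df_vcomp : forall (A B C : D) (g : vhom B C) (f : vhom A B),
    globular_iso (vcomp (df_ver df_data g) (df_ver df_data f))
                 (df_ver df_data (vcomp g f));
  df_vid_natural : forall (A B : D) (t : hom A B),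
    sq_hcomp (df_vid B) (sq_vid (df_hor df_data t))
      ≡ sq_hcomp (df_sq df_data (sq_vid t)) (df_vid A);
  df_vcomp_natural : forall (A0 A1 B0 B1 C0 C1 : D)
    (t : hom A0 A1) (m : hom B0 B1) (b : hom C0 C1)
    (l' : vhom B0 C0) (r' : vhom B1 C1) (l : vhom A0 B0) (r : vhom A1 B1)
    (s' : sq m b l' r') (s : sq t m l r),
    sq_hcomp (df_vcomp r' r) (sq_vcomp (df_sq df_data s') (df_sq df_data s))
      ≡ sq_hcomp (df_sq df_data (sq_vcomp s' s)) (df_vcomp l' l);
  df_vassoc : forall (A B C E : D) (h : vhom C E) (g : vhom B C) (f : vhom A B),
    sq_hcomp (df_sq df_data (vassoc h g f))
        (sq_hcomp (df_vcomp h (vcomp g f))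
           (sq_vcomp (sq_hid (df_ver df_data h)) (df_vcomp g f)))
      ≡ sq_hcomp (df_vcomp (vcomp h g) f)
          (sq_hcomp (sq_vcomp (df_vcomp h g) (sq_hid (df_ver df_data f)))
             (vassoc (df_ver df_data h) (df_ver df_data g) (df_ver df_data f)));
  df_vunitl : forall (A B : D) (f : vhom A B),
    sq_hcomp (df_sq df_data (vunitl f))
        (sq_hcomp (df_vcomp (vid B) f)
           (sq_vcomp (df_vid B) (sq_hid (df_ver df_data f))))
      ≡ vunitl (df_ver df_data f);
  df_vunitr : forall (A B : D) (f : vhom A B),
    sq_hcomp (df_sq df_data (vunitr f))
        (sq_hcomp (df_vcomp f (vid A))
           (sq_vcomp (sq_hid (df_ver df_data f)) (df_vid A)))
      ≡ vunitr (df_ver df_data f)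
}.
Arguments df_vid {D D'} _ A.
Arguments df_vcomp {D D'} _ {A B C} g f.

(** Lax double functors from [D] to categories, functors and profunctors.  A
    map of profunctors out of a composite [E(g) ⊗ E(g')] (a coend) is given as
    a family [E(g)(x,y) * E(g')(y,z) -> _] that is balanced in [y]. *)

Record indexed_data (D : double_category) := IndexedData {
  ix_ob :> D -> category;
  ix_ver : forall A B : D, vhom A B -> functor (ix_ob A) (ix_ob B);
  ix_hor : forall A B : D, hom A B -> profunctor (ix_ob A) (ix_ob B);
  ix_sq : forall (A B A' B' : D) (t : hom A B) (b : hom A' B')
    (l : vhom A A') (r : vhom B B') (s : sq t b l r) (x : ix_ob A) (y : ix_ob B),
    ix_hor t x y -> ix_hor b (ix_ver l x) (ix_ver r y);
  ix_unit : forall (A : D) (x y : ix_ob A), hom x y -> ix_hor (idm A) x y;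
  ix_lax : forall (A B C : D) (g : hom A B) (g' : hom B C)
    (x : ix_ob A) (y : ix_ob B) (z : ix_ob C),
    ix_hor g x y -> ix_hor g' y z -> ix_hor (g' ∘ g) x z;
  ix_vid : forall (A : D) (x : ix_ob A), iso x (ix_ver (vid A) x);
  ix_vcomp : forall (A B C : D) (g : vhom B C) (f : vhom A B) (x : ix_ob A),
    iso (ix_ver g (ix_ver f x)) (ix_ver (vcomp g f) x)
}.
Arguments ix_ver {D} _ {A B} _.
Arguments ix_hor {D} _ {A B} _.
Arguments ix_sq {D} _ {A B A' B' t b l r} s {x y} _.
Arguments ix_unit {D} _ {A x y} _.
Arguments ix_lax {D} _ {A B C g g' x y z} _ _.
Arguments ix_vid {D} _ {A} x.
Arguments ix_vcomp {D} _ {A B C} g f x.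

Definition ix_total (D : double_category) (E : indexed_data D) (A B : D)
    (x : E A) (y : E B) (g : hom A B) (p : ix_hor E g x y) :
    {g : hom A B & ix_hor E g x y} :=
  existT _ g p.

Notation "p ≈ q" := (ix_total p = ix_total q) (at level 70, no associativity).

Record indexed_double_category (D : double_category) := IndexedDoubleCategory {
  ix_data :> indexed_data D;
  ix_sq_lact : forall (A B A' B' : D) (t : hom A B) (b : hom A' B')
    (l : vhom A A') (r : vhom B B') (s : sq t b l r)
    (x x' : ix_data A) (y : ix_data B) (f : hom x' x) (p : ix_hor ix_data t x y),
    ix_sq ix_data s (lact f p) = lact (fmap (ix_ver ix_data l) f) (ix_sq ix_data s p);
  ix_sq_ract : forall (A B A' B' : D) (t : hom A B) (b : hom A' B')
    (l : vhom A A') (r : vhom B B') (s : sq t b l r)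
    (x : ix_data A) (y y' : ix_data B) (f : hom y y') (p : ix_hor ix_data t x y),
    ix_sq ix_data s (ract f p) = ract (fmap (ix_ver ix_data r) f) (ix_sq ix_data s p);
  ix_unit_lact : forall (A : D) (x' x y : ix_data A) (f : hom x y) (h : hom x' x),
    ix_unit ix_data (f ∘ h) = lact h (ix_unit ix_data f);
  ix_unit_ract : forall (A : D) (x y y' : ix_data A) (h : hom y y') (f : hom x y),
    ix_unit ix_data (h ∘ f) = ract h (ix_unit ix_data f);
  ix_lax_lact : forall (A B C : D) (g : hom A B) (g' : hom B C)
    (x' x : ix_data A) (y : ix_data B) (z : ix_data C) (f : hom x' x)
    (p : ix_hor ix_data g x y) (q : ix_hor ix_data g' y z),
    ix_lax ix_data (lact f p) q = lact f (ix_lax ix_data p q);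
  ix_lax_ract : forall (A B C : D) (g : hom A B) (g' : hom B C)
    (x : ix_data A) (y : ix_data B) (z z' : ix_data C) (f : hom z z')
    (p : ix_hor ix_data g x y) (q : ix_hor ix_data g' y z),
    ix_lax ix_data p (ract f q) = ract f (ix_lax ix_data p q);
  ix_lax_balanced : forall (A B C : D) (g : hom A B) (g' : hom B C)
    (x : ix_data A) (y y' : ix_data B) (z : ix_data C) (f : hom y y')
    (p : ix_hor ix_data g x y) (q : ix_hor ix_data g' y' z),
    ix_lax ix_data (ract f p) q = ix_lax ix_data p (lact f q);
  ix_lax_assoc : forall (A B C E : D) (g : hom A B) (h : hom B C) (k : hom C E)
    (x : ix_data A) (y : ix_data B) (z : ix_data C) (w : ix_data E)
    (p : ix_hor ix_data g x y) (q : ix_hor ix_data h y z)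
    (r : ix_hor ix_data k z w),
    ix_lax ix_data (ix_lax ix_data p q) r ≈ ix_lax ix_data p (ix_lax ix_data q r);
  ix_lax_unitl : forall (A B : D) (g : hom A B) (x' x : ix_data A)
    (y : ix_data B) (f : hom x' x) (p : ix_hor ix_data g x y),
    ix_lax ix_data (ix_unit ix_data f) p ≈ lact f p;
  ix_lax_unitr : forall (A B : D) (g : hom A B) (x : ix_data A)
    (y y' : ix_data B) (f : hom y y') (p : ix_hor ix_data g x y),
    ix_lax ix_data p (ix_unit ix_data f) ≈ ract f p;
  ix_sq_hid : forall (A B : D) (v : vhom A B) (x y : ix_data A) (f : hom x y),
    ix_sq ix_data (sq_hid v) (ix_unit ix_data f)
      = ix_unit ix_data (fmap (ix_ver ix_data v) f);
  ix_sq_hcomp : forall (A0 A1 A2 C0 C1 C2 : D)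
    (t' : hom A1 A2) (b' : hom C1 C2) (t : hom A0 A1) (b : hom C0 C1)
    (l : vhom A0 C0) (m : vhom A1 C1) (r : vhom A2 C2)
    (s' : sq t' b' m r) (s : sq t b l m)
    (x : ix_data A0) (y : ix_data A1) (z : ix_data A2)
    (p : ix_hor ix_data t x y) (q : ix_hor ix_data t' y z),
    ix_sq ix_data (sq_hcomp s' s) (ix_lax ix_data p q)
      = ix_lax ix_data (ix_sq ix_data s p) (ix_sq ix_data s' q);
  ix_vid_natural : forall (A : D) (x y : ix_data A) (f : hom x y),
    iso_to (ix_vid ix_data y) ∘ f
      = fmap (ix_ver ix_data (vid A)) f ∘ iso_to (ix_vid ix_data x);
  ix_vcomp_natural : forall (A B C : D) (g : vhom B C) (f : vhom A B)
    (x y : ix_data A) (h : hom x y),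
    iso_to (ix_vcomp ix_data g f y) ∘ fmap (ix_ver ix_data g) (fmap (ix_ver ix_data f) h)
      = fmap (ix_ver ix_data (vcomp g f)) h ∘ iso_to (ix_vcomp ix_data g f x);
  ix_sq_vid : forall (A B : D) (t : hom A B) (x : ix_data A) (y : ix_data B)
    (p : ix_hor ix_data t x y),
    ract (iso_to (ix_vid ix_data y)) p
      = lact (iso_to (ix_vid ix_data x)) (ix_sq ix_data (sq_vid t) p);
  ix_sq_vcomp : forall (A0 A1 B0 B1 C0 C1 : D)
    (t : hom A0 A1) (m : hom B0 B1) (b : hom C0 C1)
    (l' : vhom B0 C0) (r' : vhom B1 C1) (l : vhom A0 B0) (r : vhom A1 B1)
    (s' : sq m b l' r') (s : sq t m l r)
    (x : ix_data A0) (y : ix_data A1) (p : ix_hor ix_data t x y),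
    ract (iso_to (ix_vcomp ix_data r' r y)) (ix_sq ix_data s' (ix_sq ix_data s p))
      = lact (iso_to (ix_vcomp ix_data l' l x)) (ix_sq ix_data (sq_vcomp s' s) p);
  ix_vassoc : forall (A B C E : D) (h : vhom C E) (g : vhom B C) (f : vhom A B)
    (x : ix_data A),
    lact (iso_to (ix_vcomp ix_data h (vcomp g f) x)
            ∘ fmap (ix_ver ix_data h) (iso_to (ix_vcomp ix_data g f x)))
         (ix_sq ix_data (vassoc h g f) (ix_unit ix_data (idm x)))
      = ix_unit ix_data (iso_to (ix_vcomp ix_data (vcomp h g) f x)
            ∘ iso_to (ix_vcomp ix_data h g (ix_ver ix_data f x)));
  ix_vunitl : forall (A B : D) (f : vhom A B) (x : ix_data A),
    lact (iso_to (ix_vcomp ix_data (vid B) f x)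
            ∘ iso_to (ix_vid ix_data (ix_ver ix_data f x)))
         (ix_sq ix_data (vunitl f) (ix_unit ix_data (idm x)))
      = ix_unit ix_data (idm (ix_ver ix_data f x));
  ix_vunitr : forall (A B : D) (f : vhom A B) (x : ix_data A),
    lact (iso_to (ix_vcomp ix_data f (vid A) x)
            ∘ fmap (ix_ver ix_data f) (iso_to (ix_vid ix_data x)))
         (ix_sq ix_data (vunitr f) (ix_unit ix_data (idm x)))
      = ix_unit ix_data (idm (ix_ver ix_data f x))
}.

(** The underlying data of a transformation [E => E' ∘ K]; its functoriality,
    its isomorphisms [E'(K v) ∘ α ≅ α ∘ E(v)] and its laws are in
    [transformation]. *)
Record transformation_data (D D' : double_category) (E : indexed_data D)
    (E' : indexed_data D') (K : double_functor_data D D') := TransformationData {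
  tr_ob : forall A : D, E A -> E' (K A);
  tr_mor : forall (A : D) (x y : E A), hom x y -> hom (tr_ob x) (tr_ob y);
  tr_hor : forall (A B : D) (g : hom A B) (x : E A) (y : E B),
    ix_hor E g x y -> ix_hor E' (df_hor K g) (tr_ob x) (tr_ob y)
}.
Arguments tr_ob {D D' E E' K} _ {A} _.
Arguments tr_mor {D D' E E' K} _ {A x y} _.
Arguments tr_hor {D D' E E' K} _ {A B g x y} _.

Record transformation (D D' : double_category) (E : indexed_double_category D)
    (E' : indexed_double_category D') (K : double_functor D D') := Transformation {
  tr_data :> transformation_data E E' K;
  tr_mor_id : forall (A : D) (x : E A), tr_mor tr_data (idm x) = idm (tr_ob tr_data x);
  tr_mor_comp : forall (A : D) (x y z : E A) (g : hom y z) (f : hom x y),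
    tr_mor tr_data (g ∘ f) = tr_mor tr_data g ∘ tr_mor tr_data f;
  tr_ver : forall (A B : D) (v : vhom A B) (x : E A),
    iso (ix_ver E' (df_ver K v) (tr_ob tr_data x)) (tr_ob tr_data (ix_ver E v x));
  tr_ver_natural : forall (A B : D) (v : vhom A B) (x y : E A) (f : hom x y),
    iso_to (tr_ver v y) ∘ fmap (ix_ver E' (df_ver K v)) (tr_mor tr_data f)
      = tr_mor tr_data (fmap (ix_ver E v) f) ∘ iso_to (tr_ver v x);
  tr_ver_vid : forall (A : D) (x : E A),
    ract (iso_to (tr_ver (vid A) x))
      (lact (iso_to (ix_vid E' (tr_ob tr_data x)))
         (ix_sq E' (df_vid K A) (ix_unit E' (idm (tr_ob tr_data x)))))
      = ix_unit E' (tr_mor tr_data (iso_to (ix_vid E x)));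
  tr_ver_vcomp : forall (A B C : D) (g : vhom B C) (f : vhom A B) (x : E A),
    ract (iso_to (tr_ver (vcomp g f) x))
      (lact (iso_to (ix_vcomp E' (df_ver K g) (df_ver K f) (tr_ob tr_data x)))
         (ix_sq E' (df_vcomp K g f) (ix_unit E' (idm (tr_ob tr_data x)))))
      = ix_unit E' (tr_mor tr_data (iso_to (ix_vcomp E g f x))
          ∘ iso_to (tr_ver g (ix_ver E f x))
          ∘ fmap (ix_ver E' (df_ver K g)) (iso_to (tr_ver f x)));
  tr_hor_lact : forall (A B : D) (g : hom A B) (x' x : E A) (y : E B)
    (f : hom x' x) (p : ix_hor E g x y),
    tr_hor tr_data (lact f p) = lact (tr_mor tr_data f) (tr_hor tr_data p);
  tr_hor_ract : forall (A B : D) (g : hom A B) (x : E A) (y y' : E B)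
    (f : hom y y') (p : ix_hor E g x y),
    tr_hor tr_data (ract f p) = ract (tr_mor tr_data f) (tr_hor tr_data p);
  tr_hor_unit : forall (A : D) (x y : E A) (f : hom x y),
    tr_hor tr_data (ix_unit E f) ≈ ix_unit E' (tr_mor tr_data f);
  tr_hor_lax : forall (A B C : D) (g : hom A B) (g' : hom B C)
    (x : E A) (y : E B) (z : E C) (p : ix_hor E g x y) (q : ix_hor E g' y z),
    tr_hor tr_data (ix_lax E p q)
      ≈ ix_lax E' (tr_hor tr_data p) (tr_hor tr_data q);
  tr_sq : forall (A B A' B' : D) (t : hom A B) (b : hom A' B')
    (l : vhom A A') (r : vhom B B') (s : sq t b l r) (x : E A) (y : E B)
    (p : ix_hor E t x y),
    ract (iso_to (tr_ver r y)) (ix_sq E' (df_sq K s) (tr_hor tr_data p))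
      = lact (iso_to (tr_ver l x)) (tr_hor tr_data (ix_sq E s p))
}.

Record indexed_double_functor_data (D D' : double_category) (E : indexed_data D)
    (E' : indexed_data D') := IndexedDoubleFunctorData {
  idf_base_data : double_functor_data D D';
  idf_trans_data : transformation_data E E' idf_base_data
}.

Record indexed_double_functor (D D' : double_category)
    (E : indexed_double_category D) (E' : indexed_double_category D') :=
    IndexedDoubleFunctor {
  idf_base : double_functor D D';
  idf_trans : transformation E E' idf_base
}.

Definition idf_data (D D' : double_category) (E : indexed_double_category D)
    (E' : indexed_double_category D') (F : indexed_double_functor E E') :
    indexed_double_functor_data E E' :=
  IndexedDoubleFunctorData (tr_data (idf_trans F)).

Lemma sig_eq (A : Type) (P : A -> Prop) (x y : sig P) :
  proj1_sig x = proj1_sig y -> x = y.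
Proof.
case: x y => [x px] [y py] /= e; case: y / e py => py.
by rewrite (proof_irrelevance _ px py).
Qed.

Record span (C : category) (A B : C) := Span {
  apex : C;
  span_l : hom apex A;
  span_r : hom apex B
}.

Record span_map (C : category) (A B A' B' : C) (t : hom A B) (b : hom A' B')
    (l : span A A') (r : span B B') := SpanMap {
  span_mor : hom (apex l) (apex r);
  span_mor_l : span_l r ∘ span_mor = t ∘ span_l l;
  span_mor_r : span_r r ∘ span_mor = b ∘ span_r l
}.

Lemma span_map_eq (C : category) (A B A' B' : C) (t : hom A B) (b : hom A' B')
    (l : span A A') (r : span B B') (s s' : span_map t b l r) :
  span_mor s = span_mor s' -> s = s'.
Proof.
case: s s' => [s a1 a2] [s' b1 b2] /= e; case: s' / e b1 b2 => b1 b2.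
by rewrite (proof_irrelevance _ a1 b1) (proof_irrelevance _ a2 b2).
Qed.

Definition fmap_span (C C' : category) (F : functor C C') (A B : C)
    (v : span A B) : span (F A) (F B) :=
  Span (fmap F (span_l v)) (fmap F (span_r v)).

Program Definition fmap_span_map (C C' : category) (F : functor C C')
    (A B A' B' : C) (t : hom A B) (b : hom A' B') (l : span A A')
    (r : span B B') (s : span_map t b l r) :
    span_map (fmap F t) (fmap F b) (fmap_span F l) (fmap_span F r) :=
  SpanMap (span_mor := fmap F (span_mor s)) _ _.
Next Obligation. by move=> *; rewrite /= -!fmap_comp span_mor_l. Qed.
Next Obligation. by move=> *; rewrite /= -!fmap_comp span_mor_r. Qed.

(** The chosen pullback of sets. *)
Definition pullback (X Y Z : Type) (f : X -> Z) (g : Y -> Z) : Type :=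
  {p : X * Y | f (fst p) = g (snd p)}.

Definition pb (X Y Z : Type) (f : X -> Z) (g : Y -> Z) (x : X) (y : Y)
    (e : f x = g y) : pullback f g :=
  exist _ (x, y) e.

Definition pb1 (X Y Z : Type) (f : X -> Z) (g : Y -> Z) (p : pullback f g) : X :=
  fst (proj1_sig p).

Definition pb2 (X Y Z : Type) (f : X -> Z) (g : Y -> Z) (p : pullback f g) : Y :=
  snd (proj1_sig p).

Lemma pb_eq (X Y Z : Type) (f : X -> Z) (g : Y -> Z) (p : pullback f g) :
  f (pb1 p) = g (pb2 p).
Proof. exact: proj2_sig p. Qed.

Lemma pb_ext (X Y Z : Type) (f : X -> Z) (g : Y -> Z) (p q : pullback f g) :
  pb1 p = pb1 q -> pb2 p = pb2 q -> p = q.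
Proof.
move: p q => [[x y] p] [[x' y'] q]; rewrite /pb1 /pb2 /= => e e'.
by apply: sig_eq; rewrite /= e e'.
Qed.

Definition span_id (A : Sets) : span A A := Span (idm A) (idm A).

Definition span_comp (A B C : Sets) (w : span B C) (v : span A B) : span A C :=
  @Span Sets A C (pullback (span_r v) (span_l w))
    (fun p => span_l v (pb1 p)) (fun p => span_r w (pb2 p)).

Section SpanSquares.

Variables (A0 A1 B0 B1 C0 C1 : Sets).

Definition span_map_hid (v : span A0 B0) : span_map (idm A0) (idm B0) v v :=
  @SpanMap Sets _ _ _ _ (idm A0) (idm B0) v v (idm (apex v)) eq_refl eq_refl.

Definition span_map_vid (t : A0 -> A1) :
    span_map (t : hom A0 A1) (t : hom A0 A1) (span_id A0) (span_id A1) :=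
  @SpanMap Sets _ _ _ _ t t (span_id A0) (span_id A1) t eq_refl eq_refl.

Variables (t : hom A0 A1) (m : hom B0 B1) (b : hom C0 C1).
Variables (l' : span B0 C0) (r' : span B1 C1) (l : span A0 B0) (r : span A1 B1).
Variables (s' : span_map m b l' r') (s : span_map t m l r).

Lemma span_map_vcomp_subproof (p : pullback (span_r l) (span_l l')) :
  span_r r (span_mor s (pb1 p)) = span_l r' (span_mor s' (pb2 p)).
Proof.
rewrite (equal_f (span_mor_r s) (pb1 p) : span_r r _ = m _).
rewrite (equal_f (span_mor_l s') (pb2 p) : span_l r' _ = m _).
by congr m; apply: pb_eq.
Qed.

Program Definition span_map_vcomp : span_map t b (span_comp l' l) (span_comp r' r) :=
  @SpanMap Sets _ _ _ _ t b (span_comp l' l) (span_comp r' r)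
    (fun p => pb (span_map_vcomp_subproof p)) _ _.
Next Obligation.
by apply: functional_extensionality => p; apply: (equal_f (span_mor_l s) (pb1 p)).
Qed.
Next Obligation.
by apply: functional_extensionality => p; apply: (equal_f (span_mor_r s') (pb2 p)).
Qed.

End SpanSquares.

Program Definition span_map_hcomp (A0 A1 A2 C0 C1 C2 : Sets)
    (t' : hom A1 A2) (b' : hom C1 C2) (t : hom A0 A1) (b : hom C0 C1)
    (l : span A0 C0) (m : span A1 C1) (r : span A2 C2)
    (s' : span_map t' b' m r) (s : span_map t b l m) :
    span_map (t' ∘ t) (b' ∘ b) l r :=
  SpanMap (span_mor := span_mor s' ∘ span_mor s) _ _.
Next Obligation.
by move=> *; rewrite comp_assoc span_mor_l -comp_assoc span_mor_l comp_assoc.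
Qed.
Next Obligation.
by move=> *; rewrite comp_assoc span_mor_r -comp_assoc span_mor_r comp_assoc.
Qed.

Definition span_double_data : double_data :=
  @DoubleData Sets (@span Sets) span_id span_comp (@span_map Sets)
    span_map_hid span_map_hcomp span_map_vid span_map_vcomp.

(* Horizontal composition of maps of sets is strict up to conversion, so the
   comparison [≡] of squares of spans reduces to an equality of functions. *)
Lemma span_sq_total_eq (A B A' B' : span_double_data) (l : vhom A A')
    (r : vhom B B') (t : hom A B) (b : hom A' B') (s s' : sq t b l r) :
  (forall z, span_mor s z = span_mor s' z) -> s ≡ s'.
Proof.
move=> e; congr sq_total; apply: span_map_eq.
exact: functional_extensionality.
Qed.

Section SpanGlobular.

Variables (A B C E : Sets) (h : span C E) (g : span B C) (f : span A B).

Definition span_assoc_to :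
    @sq span_double_data _ _ _ _ (idm A) (idm E)
      (span_comp h (span_comp g f)) (span_comp (span_comp h g) f) :=
  @SpanMap Sets _ _ _ _ (idm A) (idm E)
    (span_comp h (span_comp g f)) (span_comp (span_comp h g) f)
    (fun p => @pb _ _ _ (span_r f) (span_l (span_comp h g)) (pb1 (pb1 p))
        (@pb _ _ _ (span_r g) (span_l h) (pb2 (pb1 p)) (pb2 p) (pb_eq p))
        (pb_eq (pb1 p))) eq_refl eq_refl.

Definition span_assoc_from :
    @sq span_double_data _ _ _ _ (idm A) (idm E)
      (span_comp (span_comp h g) f) (span_comp h (span_comp g f)) :=
  @SpanMap Sets _ _ _ _ (idm A) (idm E)
    (span_comp (span_comp h g) f) (span_comp h (span_comp g f))
    (fun p => @pb _ _ _ (span_r (span_comp g f)) (span_l h)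
        (@pb _ _ _ (span_r f) (span_l g) (pb1 p) (pb1 (pb2 p)) (pb_eq p))
        (pb2 (pb2 p)) (pb_eq (pb2 p))) eq_refl eq_refl.

Lemma span_assoc_fromK : sq_hcomp span_assoc_from span_assoc_to ≡ sq_hid _.
Proof. by apply: span_sq_total_eq => p; do !apply: pb_ext. Qed.

Lemma span_assoc_toK : sq_hcomp span_assoc_to span_assoc_from ≡ sq_hid _.
Proof. by apply: span_sq_total_eq => p; do !apply: pb_ext. Qed.

Definition span_assoc :
    @globular_iso span_double_data _ _
      (span_comp h (span_comp g f)) (span_comp (span_comp h g) f) :=
  GlobularIso span_assoc_fromK span_assoc_toK.

Definition span_unitl_to :
    @sq span_double_data _ _ _ _ (idm A) (idm B) (span_comp (span_id B) f) f :=
  @SpanMap Sets _ _ _ _ (idm A) (idm B) (span_comp (span_id B) f) f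
    (fun p => pb1 p) eq_refl
    (functional_extensionality (fun p => span_r f (pb1 p)) (fun p => pb2 p)
       (@pb_eq _ _ _ (span_r f) (span_l (span_id B)))).

Definition span_unitl_from :
    @sq span_double_data _ _ _ _ (idm A) (idm B) f (span_comp (span_id B) f) :=
  @SpanMap Sets _ _ _ _ (idm A) (idm B) f (span_comp (span_id B) f)
    (fun z => @pb _ _ _ (span_r f) (span_l (span_id B)) z (span_r f z) eq_refl) eq_refl eq_refl.

Lemma span_unitl_fromK : sq_hcomp span_unitl_from span_unitl_to ≡ sq_hid _.
Proof. by apply: span_sq_total_eq => p; apply: pb_ext => //=; apply: pb_eq. Qed.

Lemma span_unitl_toK : sq_hcomp span_unitl_to span_unitl_from ≡ sq_hid _.
Proof. exact: span_sq_total_eq. Qed.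

Definition span_unitl : @globular_iso span_double_data _ _ (span_comp (span_id B) f) f :=
  GlobularIso span_unitl_fromK span_unitl_toK.

Definition span_unitr_to :
    @sq span_double_data _ _ _ _ (idm A) (idm B) (span_comp f (span_id A)) f :=
  @SpanMap Sets _ _ _ _ (idm A) (idm B) (span_comp f (span_id A)) f
    (fun p => pb2 p)
    (functional_extensionality (fun p => span_l f (pb2 p)) (fun p => pb1 p)
       (fun p => eq_sym (@pb_eq _ _ _ (span_r (span_id A)) (span_l f) p))) eq_refl.

Definition span_unitr_from :
    @sq span_double_data _ _ _ _ (idm A) (idm B) f (span_comp f (span_id A)) :=
  @SpanMap Sets _ _ _ _ (idm A) (idm B) f (span_comp f (span_id A))
    (fun z => @pb _ _ _ (span_r (span_id A)) (span_l f) (span_l f z) z eq_refl) eq_refl eq_refl.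

Lemma span_unitr_fromK : sq_hcomp span_unitr_from span_unitr_to ≡ sq_hid _.
Proof. by apply: span_sq_total_eq => p; apply: pb_ext => //=; apply: eq_sym (pb_eq p). Qed.

Lemma span_unitr_toK : sq_hcomp span_unitr_to span_unitr_from ≡ sq_hid _.
Proof. exact: span_sq_total_eq. Qed.

Definition span_unitr : @globular_iso span_double_data _ _ (span_comp f (span_id A)) f :=
  GlobularIso span_unitr_fromK span_unitr_toK.

End SpanGlobular.

Program Definition SpanSets : double_category :=
  @DoubleCategory span_double_data _ _ _ _ _ _ _
    span_assoc span_unitl span_unitr _ _ _ _ _.
Next Obligation. by move=> *; apply: span_sq_total_eq. Qed.
Next Obligation. by move=> *; apply: span_sq_total_eq. Qed.
Next Obligation. by move=> *; apply: span_sq_total_eq. Qed.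
Next Obligation. by move=> *; apply: span_map_eq. Qed.
Next Obligation. by move=> *; apply: span_map_eq. Qed.
Next Obligation.
by move=> *; apply: span_map_eq; apply: functional_extensionality => p; apply: pb_ext.
Qed.
Next Obligation.
by move=> *; apply: span_map_eq; apply: functional_extensionality => p; apply: pb_ext.
Qed.
Next Obligation. by move=> *; apply: span_sq_total_eq => p; do !apply: pb_ext. Qed.
Next Obligation. by move=> *; apply: span_sq_total_eq. Qed.
Next Obligation. by move=> *; apply: span_sq_total_eq. Qed.
Next Obligation. by move=> *; apply: span_sq_total_eq => p; do !apply: pb_ext. Qed.
Next Obligation. 
move=> *; apply: span_sq_total_eq => p; do !apply: pb_ext => //=.
Qed.

Record slice_ob (C : category) (x : C) := SliceOb {
  slice_dom : C;
  slice_map : hom slice_dom x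
}.

Definition slice_over (C : category) (x y : C) (f : hom x y)
    (a : slice_ob x) (b : slice_ob y) : Type :=
  {k : hom (slice_dom a) (slice_dom b) | slice_map b ∘ k = f ∘ slice_map a}.

Program Definition slice (C : category) (x : C) : category :=
  @Category (slice_ob x)
    (fun a b => {k : hom (slice_dom a) (slice_dom b) | slice_map b ∘ k = slice_map a})
    (fun a => exist _ (idm (slice_dom a)) _)
    (fun a b c g f => exist _ (proj1_sig g ∘ proj1_sig f) _) _ _ _.
Next Obligation. by move=> *; rewrite /= comp_idr. Qed.
Next Obligation. by move=> C x a b c [g eg] [f ef]; rewrite /= comp_assoc eg. Qed.
Next Obligation. by move=> *; apply: sig_eq; rewrite /= comp_idl. Qed.
Next Obligation. by move=> *; apply: sig_eq; rewrite /= comp_idr. Qed.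
Next Obligation. by move=> *; apply: sig_eq; rewrite /= comp_assoc. Qed.

Program Definition slice_profunctor (C : category) (x y : C) (f : hom x y) :
    profunctor (slice x) (slice y) :=
  @Profunctor (slice x) (slice y) (slice_over f)
    (fun a' a b h k => exist _ (proj1_sig k ∘ proj1_sig h) _)
    (fun a b b' h k => exist _ (proj1_sig h ∘ proj1_sig k) _) _ _ _ _ _.
Next Obligation.
by move=> C x y f a' a b [h eh] [k ek]; rewrite /= comp_assoc ek -comp_assoc eh.
Qed.
Next Obligation.
by move=> C x y f a b b' [h eh] [k ek]; rewrite /= comp_assoc eh ek.
Qed.
Next Obligation. by move=> *; apply: sig_eq; rewrite /= comp_idr. Qed.
Next Obligation. by move=> *; apply: sig_eq; rewrite /= comp_assoc. Qed.
Next Obligation. by move=> *; apply: sig_eq; rewrite /= comp_idl. Qed.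
Next Obligation. by move=> *; apply: sig_eq; rewrite /= comp_assoc. Qed.
Next Obligation. by move=> *; apply: sig_eq; rewrite /= comp_assoc. Qed.

(** Pull back along the left leg, then compose with the right leg. *)
Definition slice_span_ob (A B : Sets) (v : span A B) (x : slice A) : slice B :=
  @SliceOb Sets B (pullback (slice_map x) (span_l v)) (fun p => span_r v (pb2 p)).

Section SliceSpan.

Variables (A B A' B' : Sets) (t : hom A B) (b : hom A' B').
Variables (l : span A A') (r : span B B') (s : span_map t b l r).
Variables (x : slice A) (y : slice B) (k : slice_over t x y).

Lemma slice_span_map_subproof (p : pullback (slice_map x) (span_l l)) :
  slice_map y (proj1_sig k (pb1 p)) = span_l r (span_mor s (pb2 p)).
Proof.
rewrite (equal_f (proj2_sig k) (pb1 p) : slice_map y _ = t _).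
rewrite (equal_f (span_mor_l s) (pb2 p) : span_l r _ = t _).
by congr t; apply: pb_eq.
Qed.

Definition slice_span_map :
    slice_over b (slice_span_ob l x) (slice_span_ob r y) :=
  exist _
    (fun p : pullback (slice_map x) (span_l l) => pb (slice_span_map_subproof p))
    (functional_extensionality (fun p => span_r r (span_mor s (pb2 p)))
       (fun p => b (span_r l (pb2 p))) (fun p => equal_f (span_mor_r s) (pb2 p))).

End SliceSpan.

Lemma slice_over_id (C : category) (x : C) (a b : slice_ob x)
    (k : hom (slice_dom a) (slice_dom b)) :
  slice_map b ∘ k = slice_map a -> slice_map b ∘ k = idm x ∘ slice_map a.
Proof. by rewrite comp_idl. Qed.

Definition slice_unit (C : category) (x : C) (a b : slice x) (k : hom a b) :
    slice_over (idm x) a b :=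
  exist _ (proj1_sig k) (slice_over_id (proj2_sig k)).

Program Definition slice_lax (C : category) (x y z : C) (f : hom x y) (g : hom y z)
    (a : slice x) (b : slice y) (c : slice z) (k : slice_over f a b)
    (h : slice_over g b c) : slice_over (g ∘ f) a c :=
  exist _ (proj1_sig h ∘ proj1_sig k) _.
Next Obligation.
by move=> C x y z f g a b c [k ek] [h eh]; rewrite /= comp_assoc eh -comp_assoc ek comp_assoc.
Qed.

Program Definition slice_span (A B : Sets) (v : span A B) : functor (slice A) (slice B) :=
  @Functor (slice A) (slice B) (slice_span_ob v)
    (fun x y k => slice_span_map (span_map_hid v) (slice_unit k)) _ _.
Next Obligation.
by move=> *; apply: sig_eq; apply: functional_extensionality => p; apply: pb_ext.
Qed.
Next Obligation.
by move=> *; apply: sig_eq; apply: functional_extensionality => p; apply: pb_ext.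
Qed.

Lemma slice_eq (A : Sets) (x y : slice A) (k k' : hom x y) :
  (forall z, proj1_sig k z = proj1_sig k' z) -> k = k'.
Proof. by move=> e; apply: sig_eq; apply: functional_extensionality. Qed.

Lemma slice_over_eq (A B : Sets) (f : hom A B) (x : slice A) (y : slice B)
    (k k' : slice_over f x y) :
  (forall z, proj1_sig k z = proj1_sig k' z) -> k = k'.
Proof. by move=> e; apply: sig_eq; apply: functional_extensionality. Qed.

Program Definition slice_span_vid (A : Sets) (x : slice A) :
    iso x (slice_span (span_id A) x) :=
  @Iso (slice A) x (slice_span (span_id A) x)
    (exist _ (fun z => @pb _ _ _ (slice_map x) (span_l (span_id A)) z (slice_map x z) eq_refl) _)
    (exist _ (fun p => pb1 p) _) _ _.
Next Obligation. by []. Qed.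
Next Obligation.
by move=> A x; apply: functional_extensionality => p; apply: (pb_eq p).
Qed.
Next Obligation. by move=> *; apply: slice_eq. Qed.
Next Obligation.
by move=> *; apply: slice_eq => p; apply: pb_ext => //=; apply: (pb_eq p).
Qed.

Program Definition slice_span_vcomp (A B C : Sets) (w : span B C) (v : span A B)
    (x : slice A) :
    iso (slice_span w (slice_span v x)) (slice_span (span_comp w v) x) :=
  @Iso (slice C) (slice_span w (slice_span v x)) (slice_span (span_comp w v) x)
    (exist _ (fun p : pullback (slice_map (slice_span v x)) (span_l w) =>
        @pb _ _ _ (slice_map x) (span_l (span_comp w v)) (pb1 (pb1 p))
          (@pb _ _ _ (span_r v) (span_l w) (pb2 (pb1 p)) (pb2 p) (pb_eq p))
          (pb_eq (pb1 p))) _)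
    (exist _ (fun p : pullback (slice_map x) (span_l (span_comp w v)) =>
        @pb _ _ _ (slice_map (slice_span v x)) (span_l w)
          (@pb _ _ _ (slice_map x) (span_l v) (pb1 p) (pb1 (pb2 p)) (pb_eq p))
          (pb2 (pb2 p)) (pb_eq (pb2 p))) _) _ _.
Next Obligation. by []. Qed.
Next Obligation. by []. Qed.
Next Obligation. by move=> *; apply: slice_eq => p; do !apply: pb_ext. Qed.
Next Obligation. by move=> *; apply: slice_eq => p; do !apply: pb_ext. Qed.

Definition slice_indexed_data : indexed_data SpanSets :=
  @IndexedData SpanSets (@slice Sets) slice_span (@slice_profunctor Sets)
    slice_span_map (@slice_unit Sets) (@slice_lax Sets)
    slice_span_vid slice_span_vcomp.

Lemma slice_ix_total_eq (A B : SpanSets) (f : hom A B) (x : slice A) (y : slice B)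
    (k k' : slice_over f x y) :
  (forall z, proj1_sig k z = proj1_sig k' z) ->
  ix_total (E := slice_indexed_data) (k : ix_hor slice_indexed_data f x y)
    = ix_total (E := slice_indexed_data) (k' : ix_hor slice_indexed_data f x y).
Proof. by move=> e; congr ix_total; apply: slice_over_eq. Qed.

Program Definition SliceSets : indexed_double_category SpanSets :=
  @IndexedDoubleCategory SpanSets slice_indexed_data
    _ _ _ _ _ _ _ _ _ _ _ _ _ _ _ _ _ _ _.
Solve Obligations with
  move=> *; first
    [ by apply: slice_over_eq => p; do ?apply: pb_ext
    | by apply: slice_ix_total_eq
    | by apply: slice_eq => p; do ?apply: pb_ext
    | idtac ].
Next Obligation.
move=> A x y f; apply: slice_eq => z; apply: pb_ext => //=.
exact: (equal_f (proj2_sig f) z).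
Qed.
Next Obligation.
move=> A B t x y p; apply: slice_over_eq => z; apply: pb_ext => //=.
exact: (equal_f (proj2_sig p) z).
Qed.

(** A pseudofunctor [C^op -> Cat]. *)
Record indexed_category (C : category) := IndexedCategory {
  fib :> C -> category;
  pull : forall a b : C, hom a b -> functor (fib b) (fib a);
  pull_id : forall (a : C) (A : fib a), iso A (pull (idm a) A);
  pull_comp : forall (a b c : C) (g : hom b c) (f : hom a b) (A : fib c),
    iso (pull f (pull g A)) (pull (g ∘ f) A);
  pull_id_natural : forall (a : C) (A B : fib a) (k : hom A B),
    iso_to (pull_id B) ∘ k = fmap (pull (idm a)) k ∘ iso_to (pull_id A);
  pull_comp_natural : forall (a b c : C) (g : hom b c) (f : hom a b)
    (A B : fib c) (k : hom A B),
    iso_to (pull_comp g f B) ∘ fmap (pull f) (fmap (pull g) k)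
      = fmap (pull (g ∘ f)) k ∘ iso_to (pull_comp g f A);
  pull_unitl : forall (a b : C) (f : hom a b) (A : fib b),
    eq_hom (f_equal (fun k => pull k A) (comp_idl f))
      ∘ iso_to (pull_comp (idm b) f A) ∘ fmap (pull f) (iso_to (pull_id A))
      = idm (pull f A);
  pull_unitr : forall (a b : C) (f : hom a b) (A : fib b),
    eq_hom (f_equal (fun k => pull k A) (comp_idr f))
      ∘ iso_to (pull_comp f (idm a) A) ∘ iso_to (pull_id (pull f A))
      = idm (pull f A);
  pull_assoc : forall (a b c d : C) (h : hom c d) (g : hom b c) (f : hom a b)
    (A : fib d),
    eq_hom (f_equal (fun k => pull k A) (comp_assoc h g f))
      ∘ iso_to (pull_comp h (g ∘ f) A) ∘ iso_to (pull_comp g f (pull h A))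
      = iso_to (pull_comp (h ∘ g) f A) ∘ fmap (pull f) (iso_to (pull_comp h g A))
}.
Arguments pull {C} _ {a b} f.
Arguments pull_id {C} _ {a} A.
Arguments pull_comp {C} _ {a b c} g f A.

Local Notation erefl := (@eq_refl _).

Section IsoLemmas.
Variables (C : category).

Lemma iso_fromK_r (a b c : C) (i : iso a b) (f : hom a c) :
  f ∘ iso_from i ∘ iso_to i = f.
Proof. by rewrite -comp_assoc iso_fromK comp_idr. Qed.

Lemma iso_toK_r (a b c : C) (i : iso a b) (f : hom b c) :
  f ∘ iso_to i ∘ iso_from i = f.
Proof. by rewrite -comp_assoc iso_toK comp_idr. Qed.

Lemma iso_to_inj (a b c : C) (i : iso a b) (f g : hom c a) :
  iso_to i ∘ f = iso_to i ∘ g -> f = g.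
Proof.
move=> e; rewrite -[f]comp_idl -[g]comp_idl -(iso_fromK i) -!comp_assoc.
by rewrite e.
Qed.

Lemma iso_to_inj_r (a b c : C) (i : iso a b) (f g : hom b c) :
  f ∘ iso_to i = g ∘ iso_to i -> f = g.
Proof. by move=> e; rewrite -(iso_toK_r i f) e iso_toK_r. Qed.

Definition eq_iso (a b : C) (e : a = b) : iso a b.
Proof.
refine (@Iso C a b (eq_hom e) (eq_hom (eq_sym e)) _ _); by case: b / e; rewrite comp_idl.
Defined.

Definition comp_iso (a b c : C) (j : iso b c) (i : iso a b) : iso a c.
Proof.
refine (@Iso C a c (iso_to j ∘ iso_to i) (iso_from i ∘ iso_from j) _ _).
- by rewrite comp_assoc iso_fromK_r iso_fromK.
- by rewrite comp_assoc iso_toK_r iso_toK.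
Defined.

Definition fmap_iso (D : category) (F : functor C D) (a b : C) (i : iso a b) :
  iso (F a) (F b).
Proof.
refine (@Iso D _ _ (fmap F (iso_to i)) (fmap F (iso_from i)) _ _).
- by rewrite -fmap_comp iso_fromK fmap_id.
- by rewrite -fmap_comp iso_toK fmap_id.
Defined.
End IsoLemmas.

(* [comp_assoc] in the fibres only: the base maps occur as indices. *)
Lemma fib_assoc (C : category) (Bun : indexed_category C) (x : C) (a b c d : Bun x)
    (h : hom c d) (g : hom b c) (f : hom a b) : h ∘ (g ∘ f) = h ∘ g ∘ f.
Proof. exact: comp_assoc. Qed.

Section Coherence.
Variables (C : category) (Bun : indexed_category C).

(* The comparisons up to a propositional equality between base maps, sealed. *)
Lemma pull0_seal (a : C) (k : hom a a) (e : idm a = k) (A : Bun a) :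
  {i : iso A (pull Bun k A) | iso_to i =
     eq_hom (f_equal (fun k => pull Bun k A) e) ∘ iso_to (pull_id Bun A)}.
Proof. by exists (comp_iso (eq_iso (f_equal (fun k => pull Bun k A) e)) (pull_id Bun A)). Qed.

Lemma pull2_seal (a b c : C) (g : hom b c) (f : hom a b) (k : hom a c)
    (e : g ∘ f = k) (A : Bun c) :
  {i : iso (pull Bun f (pull Bun g A)) (pull Bun k A) | iso_to i =
     eq_hom (f_equal (fun k => pull Bun k A) e) ∘ iso_to (pull_comp Bun g f A)}.
Proof. by exists (comp_iso (eq_iso (f_equal (fun k => pull Bun k A) e)) (pull_comp Bun g f A)). Qed.

Definition pull0 (a : C) (k : hom a a) (e : idm a = k) (A : Bun a) :=
  proj1_sig (pull0_seal e A).

Definition pull2 (a b c : C) (g : hom b c) (f : hom a b) (k : hom a c)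
    (e : g ∘ f = k) (A : Bun c) := proj1_sig (pull2_seal e A).

Lemma pull2_toE (a b c : C) (g : hom b c) (f : hom a b) (k : hom a c)
    (e : g ∘ f = k) (A : Bun c) :
  iso_to (pull2 e A)
    = eq_hom (f_equal (fun k => pull Bun k A) e) ∘ iso_to (pull_comp Bun g f A).
Proof. exact: proj2_sig (pull2_seal e A). Qed.

Lemma pull0E (a : C) (A : Bun a) : iso_to (pull0 (erefl (idm a)) A) = iso_to (pull_id Bun A).
Proof. by rewrite (proj2_sig (pull0_seal _ _)) /= comp_idl. Qed.

Lemma pull2E (a b c : C) (g : hom b c) (f : hom a b) (A : Bun c) :
  iso_to (pull2 (erefl (g ∘ f)) A) = iso_to (pull_comp Bun g f A).
Proof. by rewrite (proj2_sig (pull2_seal _ _)) /= comp_idl. Qed.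

Lemma pull0IE (a : C) (A : Bun a) :
  iso_from (pull0 (erefl (idm a)) A) = iso_from (pull_id Bun A).
Proof.
by apply: (@iso_to_inj _ _ _ _ (pull_id Bun A)); rewrite -{1}pull0E !iso_toK.
Qed.

Lemma pull2IE (a b c : C) (g : hom b c) (f : hom a b) (A : Bun c) :
  iso_from (pull2 (erefl (g ∘ f)) A) = iso_from (pull_comp Bun g f A).
Proof.
by apply: (@iso_to_inj _ _ _ _ (pull_comp Bun g f A)); rewrite -{1}pull2E !iso_toK.
Qed.

Lemma pull2_natural (a b c : C) (g : hom b c) (f : hom a b) (k : hom a c)
    (e : g ∘ f = k) (A B : Bun c) (m : hom A B) :
  iso_to (pull2 e B) ∘ fmap (pull Bun f) (fmap (pull Bun g) m)
    = fmap (pull Bun k) m ∘ iso_to (pull2 e A).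
Proof. by case: k / e; rewrite !pull2E pull_comp_natural. Qed.

Lemma pull2I_natural (a b c : C) (g : hom b c) (f : hom a b) (k : hom a c)
    (e : g ∘ f = k) (A B : Bun c) (m : hom A B) :
  fmap (pull Bun f) (fmap (pull Bun g) m) ∘ iso_from (pull2 e A)
    = iso_from (pull2 e B) ∘ fmap (pull Bun k) m.
Proof.
apply: (@iso_to_inj _ _ _ _ (pull2 e B)).
by rewrite !comp_assoc pull2_natural iso_toK iso_toK_r comp_idl.
Qed.

Lemma pull2_unitl (a b : C) (f : hom a b) (k : hom b b) (e0 : idm b = k)
    (e : k ∘ f = f) (A : Bun b) :
  iso_to (pull2 e A) ∘ fmap (pull Bun f) (iso_to (pull0 e0 A)) = idm _.
Proof.
case: k / e0 e => e; rewrite pull0E (proof_irrelevance _ e (comp_idl f)).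
by rewrite (proj2_sig (pull2_seal _ _)) pull_unitl.
Qed.

Lemma pull2_unitr (a b : C) (f : hom a b) (k : hom a a) (e0 : idm a = k)
    (e : f ∘ k = f) (A : Bun b) :
  iso_to (pull2 e A) ∘ iso_to (pull0 e0 (pull Bun f A)) = idm _.
Proof.
case: k / e0 e => e; rewrite pull0E (proof_irrelevance _ e (comp_idr f)).
by rewrite (proj2_sig (pull2_seal _ _)) pull_unitr.
Qed.

Lemma pull2_assoc (a b c d : C) (h : hom c d) (g : hom b c) (f : hom a b)
    (hg : hom b d) (gf : hom a c) (k : hom a d) (e1 : h ∘ g = hg)
    (e2 : g ∘ f = gf) (e3 : hg ∘ f = k) (e4 : h ∘ gf = k) (A : Bun d) :
  iso_to (pull2 e4 A) ∘ iso_to (pull2 e2 (pull Bun h A))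
    = iso_to (pull2 e3 A) ∘ fmap (pull Bun f) (iso_to (pull2 e1 A)).
Proof.
case: hg / e1 e3 => e3; case: gf / e2 e4 => e4; case: k / e3 e4 => e4.
rewrite !pull2E (proof_irrelevance _ e4 (comp_assoc h g f)).
by rewrite (proj2_sig (pull2_seal (comp_assoc h g f) _)) pull_assoc.
Qed.

Lemma pull2I_assoc (a b c d : C) (h : hom c d) (g : hom b c) (f : hom a b)
    (hg : hom b d) (gf : hom a c) (k : hom a d) (e1 : h ∘ g = hg)
    (e2 : g ∘ f = gf) (e3 : hg ∘ f = k) (e4 : h ∘ gf = k) (A : Bun d) :
  iso_from (pull2 e2 (pull Bun h A)) ∘ iso_from (pull2 e4 A)
    = fmap (pull Bun f) (iso_from (pull2 e1 A)) ∘ iso_from (pull2 e3 A).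
Proof.
apply: (@iso_to_inj _ _ _ _ (comp_iso (pull2 e4 A) (pull2 e2 (pull Bun h A)))).
rewrite /= {2}(pull2_assoc e1 e2 e3 e4) !comp_assoc !iso_toK_r iso_toK.
by rewrite -[X in _ = X ∘ _]comp_assoc -fmap_comp iso_toK fmap_id comp_idr iso_toK.
Qed.

End Coherence.

Record bundle (C : category) (Bun : indexed_category C) := Bundle {
  base : C;
  fibre : Bun base
}.

Record bundle_map (C : category) (Bun : indexed_category C) (X Y : bundle Bun) :=
    BundleMap {
  bm_base : hom (base X) (base Y);
  bm_fib : hom (fibre X) (pull Bun bm_base (fibre Y))
}.

Lemma bundle_map_eq (C : category) (Bun : indexed_category C) (X Y : bundle Bun)
    (g g' : bundle_map X Y) (e : bm_base g = bm_base g') :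
  eq_hom (f_equal (fun k => pull Bun k (fibre Y)) e) ∘ bm_fib g = bm_fib g' -> g = g'.
Proof.
case: g g' e => [g m] [g' m'] /= e; case: g' / e m' => m' /=.
by rewrite comp_idl => ->.
Qed.

Definition bundle_map_id (C : category) (Bun : indexed_category C) (X : bundle Bun) :
    bundle_map X X :=
  BundleMap (iso_to (pull_id Bun (fibre X))).

Definition bundle_map_comp (C : category) (Bun : indexed_category C)
    (X Y Z : bundle Bun) (h : bundle_map Y Z) (g : bundle_map X Y) : bundle_map X Z :=
  @BundleMap C Bun X Z (bm_base h ∘ bm_base g)
    (iso_to (pull_comp Bun (bm_base h) (bm_base g) (fibre Z))
       ∘ fmap (pull Bun (bm_base g)) (bm_fib h) ∘ bm_fib g).

Program Definition grothendieck (C : category) (Bun : indexed_category C) : category :=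
  @Category (bundle Bun) (@bundle_map C Bun) (@bundle_map_id C Bun)
    (@bundle_map_comp C Bun) _ _ _.
Next Obligation.
move=> C Bun X Y g; apply: (@bundle_map_eq _ _ _ _ (bundle_map_comp (bundle_map_id Y) g) g (comp_idl _)) => /=.
by rewrite !fib_assoc pull_unitl comp_idl.
Qed.
Next Obligation.
move=> C Bun X Y g; apply: (@bundle_map_eq _ _ _ _ (bundle_map_comp g (bundle_map_id X)) g (comp_idr _)) => /=.
rewrite -fib_assoc -pull_id_natural !fib_assoc.
by rewrite pull_unitr comp_idl.
Qed.
Next Obligation.
move=> C Bun X Y Z W h g f.
apply: (@bundle_map_eq _ _ _ _ (bundle_map_comp h (bundle_map_comp g f)) (bundle_map_comp (bundle_map_comp h g) f) (comp_assoc _ _ _)) => /=.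
rewrite !fmap_comp !fib_assoc -pull_assoc; congr (_ ∘ _ ∘ _).
by rewrite -fib_assoc -pull_comp_natural fib_assoc.
Qed.

Record lens (C : category) (Bun : indexed_category C) (X Y : bundle Bun) := Lens {
  lens_get : hom (base X) (base Y);
  lens_put : hom (pull Bun lens_get (fibre Y)) (fibre X)
}.

Definition lens_id (C : category) (Bun : indexed_category C) (X : bundle Bun) :
    lens X X :=
  Lens (iso_from (pull_id Bun (fibre X))).

Definition lens_comp (C : category) (Bun : indexed_category C) (X Y Z : bundle Bun)
    (h : lens Y Z) (f : lens X Y) : lens X Z :=
  @Lens C Bun X Z (lens_get h ∘ lens_get f)
    (lens_put f ∘ fmap (pull Bun (lens_get f)) (lens_put h)
       ∘ iso_from (pull_comp Bun (lens_get h) (lens_get f) (fibre Z))).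

(** [f1^* g2^* A -> g1^* f2^* A] when [g2 f1 = f2 g1]. *)
Definition exchange (C : category) (Bun : indexed_category C) (a b c d : C)
    (g1 : hom a b) (g2 : hom c d) (f1 : hom a c) (f2 : hom b d)
    (e : g2 ∘ f1 = f2 ∘ g1) (A : Bun d) :
    hom (pull Bun f1 (pull Bun g2 A)) (pull Bun g1 (pull Bun f2 A)) :=
  iso_from (pull_comp Bun f2 g1 A)
    ∘ eq_hom (f_equal (fun k => pull Bun k A) e)
    ∘ iso_to (pull_comp Bun g2 f1 A).

(** The equation lives in [hom (f1^* A3) (g1^* A2)]; [exchange] makes the
    identification [f1^* g2^* A4 = g1^* f2^* A4] explicit. *)
Definition interface_sq (C : category) (Bun : indexed_category C)
    (X1 X2 X3 X4 : bundle Bun) (t : bundle_map X1 X2) (b : bundle_map X3 X4)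
    (l : lens X1 X3) (r : lens X2 X4) : Prop :=
  exists e : bm_base b ∘ lens_get l = lens_get r ∘ bm_base t,
    bm_fib t ∘ lens_put l
      = fmap (pull Bun (bm_base t)) (lens_put r)
          ∘ exchange e (fibre X4)
          ∘ fmap (pull Bun (lens_get l)) (bm_fib b).

Section Interface.
Variables (C : category) (Bun : indexed_category C).

(* Sealed, so that rewriting does not see through it. *)
Lemma exch_seal (a b c d : C) (g1 : hom a b) (g2 : hom c d) (f1 : hom a c)
    (f2 : hom b d) (e : g2 ∘ f1 = f2 ∘ g1) (A : Bun d) :
  {x | x = exchange e A}.
Proof. by exists (exchange e A). Qed.

Definition exch (a b c d : C) (g1 : hom a b) (g2 : hom c d) (f1 : hom a c)
    (f2 : hom b d) (e : g2 ∘ f1 = f2 ∘ g1) (A : Bun d) := proj1_sig (exch_seal e A).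

Lemma exchE (a b c d : C) (g1 : hom a b) (g2 : hom c d) (f1 : hom a c)
    (f2 : hom b d) (e : g2 ∘ f1 = f2 ∘ g1) (A : Bun d) : exchange e A = exch e A.
Proof. exact: eq_sym (proj2_sig (exch_seal e A)). Qed.

Lemma exch_pull2 (a b c d : C) (g1 : hom a b) (g2 : hom c d) (f1 : hom a c)
    (f2 : hom b d) (k : hom a d) (e : g2 ∘ f1 = f2 ∘ g1) (e1 : g2 ∘ f1 = k)
    (e2 : f2 ∘ g1 = k) (A : Bun d) :
  exch e A = iso_from (pull2 e2 A) ∘ iso_to (pull2 e1 A).
Proof.
rewrite -exchE; case: k / e2 e1 => e1; rewrite pull2IE (proof_irrelevance _ e1 e).
by rewrite (proj2_sig (pull2_seal e A)) fib_assoc.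
Qed.

Lemma exch_natural (a b c d : C) (g1 : hom a b) (g2 : hom c d) (f1 : hom a c)
    (f2 : hom b d) (e : g2 ∘ f1 = f2 ∘ g1) (A B : Bun d) (m : hom A B) :
  exch e B ∘ fmap (pull Bun f1) (fmap (pull Bun g2) m)
    = fmap (pull Bun g1) (fmap (pull Bun f2) m) ∘ exch e A.
Proof.
rewrite !(exch_pull2 e e (erefl (f2 ∘ g1))) -fib_assoc pull2_natural.
by rewrite !fib_assoc pull2I_natural.
Qed.

Local Notation P := (pull Bun).

Lemma exch_hcomp (a0 a1 a2 c0 c1 c2 : C) (t : hom a0 a1) (t' : hom a1 a2)
    (b : hom c0 c1) (b' : hom c1 c2) (l : hom a0 c0) (m : hom a1 c1) (r : hom a2 c2)
    (e : b ∘ l = m ∘ t) (e' : b' ∘ m = r ∘ t') (e'' : b' ∘ b ∘ l = r ∘ (t' ∘ t))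
    (A : Bun c2) :
  exch e'' A ∘ fmap (P l) (iso_to (pull_comp Bun b' b A))
    = iso_to (pull_comp Bun t' t (P r A)) ∘ fmap (P t) (exch e' A)
        ∘ exch e (P b' A).
Proof.
have e3 : r ∘ t' ∘ t = r ∘ (t' ∘ t) by rewrite comp_assoc.
have e5 : b' ∘ (m ∘ t) = r ∘ (t' ∘ t) by rewrite comp_assoc e' comp_assoc.
apply: (@iso_to_inj _ _ _ _ (pull2 (erefl (r ∘ (t' ∘ t))) A)).
rewrite (exch_pull2 e'' e'' (erefl _)) (exch_pull2 e' e' (erefl _)) (exch_pull2 e e (erefl _)).
rewrite !fib_assoc iso_toK comp_idl fmap_comp -!pull2E.
rewrite -(pull2_assoc (erefl (b' ∘ b)) e e'' e5).
rewrite (pull2_assoc (erefl (r ∘ t')) (erefl (t' ∘ t)) e3 (erefl _)).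
rewrite !fib_assoc -[X in _ = X ∘ _ ∘ _ ∘ _]fib_assoc -fmap_comp iso_toK fmap_id comp_idr.
by rewrite -(pull2_assoc e' (erefl (m ∘ t)) e3 e5) iso_toK_r.
Qed.

Lemma exch_vcomp (a0 a1 b0 b1 c0 c1 : C) (t : hom a0 a1) (m : hom b0 b1)
    (b : hom c0 c1) (l : hom a0 b0) (l' : hom b0 c0) (r : hom a1 b1) (r' : hom b1 c1)
    (e : m ∘ l = r ∘ t) (e' : b ∘ l' = r' ∘ m) (e'' : b ∘ (l' ∘ l) = r' ∘ r ∘ t)
    (A : Bun c1) :
  exch e (P r' A) ∘ fmap (P l) (exch e' A)
    ∘ iso_from (pull_comp Bun l' l (P b A))
  = fmap (P t) (iso_from (pull_comp Bun r' r A)) ∘ exch e'' A.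
Proof.
have e4 : r' ∘ (r ∘ t) = r' ∘ r ∘ t by rewrite comp_assoc.
have e5 : r' ∘ m ∘ l = r' ∘ r ∘ t by rewrite -e4 -e comp_assoc.
rewrite (exch_pull2 e'' e'' (erefl _)) (exch_pull2 e' e' (erefl _)) (exch_pull2 e e (erefl _)).
apply: (@iso_to_inj _ _ _ _ (fmap_iso (P t) (pull_comp Bun r' r A))).
rewrite /= !fib_assoc -fmap_comp iso_toK fmap_id comp_idl.
apply: (@iso_to_inj _ _ _ _ (pull2 (erefl (r' ∘ r ∘ t)) A)).
apply: (@iso_to_inj_r _ _ _ _ (pull_comp Bun l' l (P b A))).
rewrite !fib_assoc iso_fromK_r -!pull2E.
rewrite iso_toK comp_idl fmap_comp.
rewrite -(pull2_assoc (erefl (r' ∘ r)) (erefl (r ∘ t)) (erefl _) e4).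
rewrite !fib_assoc iso_toK_r (pull2_assoc (erefl (r' ∘ m)) e e5 e4).
rewrite -[X in X ∘ _ = _]fib_assoc -fmap_comp iso_toK fmap_id comp_idr.
by rewrite -(pull2_assoc e' (erefl (l' ∘ l)) e5 e'').
Qed.

Lemma exch_id (a b : C) (f : hom a b) (e : f ∘ idm a = idm b ∘ f) (A : Bun b) :
  exch (g1 := f) (g2 := f) (f1 := idm a) (f2 := idm b) e A
    ∘ iso_to (pull_id Bun (P f A))
  = fmap (P f) (iso_to (pull_id Bun A)).
Proof.
have e1 : f ∘ idm a = f by rewrite comp_idr.
have e2 : idm b ∘ f = f by rewrite comp_idl.
rewrite (exch_pull2 e e1 e2) -!pull0E.
apply: (@iso_to_inj _ _ _ _ (pull2 e2 A)).
by rewrite !fib_assoc iso_toK comp_idl pull2_unitr pull2_unitl.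
Qed.

Lemma exch_id' (a b : C) (f : hom a b) (e : idm b ∘ f = f ∘ idm a) (A : Bun b) :
  exch (g1 := idm a) (g2 := idm b) (f1 := f) (f2 := f) e A
    ∘ fmap (P f) (iso_to (pull_id Bun A))
  = iso_to (pull_id Bun (P f A)).
Proof.
have e1 : f ∘ idm a = f by rewrite comp_idr.
have e2 : idm b ∘ f = f by rewrite comp_idl.
rewrite (exch_pull2 e e2 e1) -!pull0E.
apply: (@iso_to_inj _ _ _ _ (pull2 e1 A)).
by rewrite !fib_assoc iso_toK comp_idl pull2_unitr pull2_unitl.
Qed.

Lemma interface_sq_hid (X Y : grothendieck Bun) (f : lens X Y) :
  interface_sq (idm X) (idm Y) f f.
Proof.
have e : idm (base Y) ∘ lens_get f = lens_get f ∘ idm (base X)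
  by rewrite comp_idl comp_idr.
exists e; rewrite exchE /=; rewrite -[X in _ = X]fib_assoc exch_id'.
exact: pull_id_natural.
Qed.

Lemma interface_sq_vid (X Y : grothendieck Bun) (t : hom X Y) :
  interface_sq t t (lens_id X) (lens_id Y).
Proof.
have e : bm_base t ∘ idm (base X) = idm (base Y) ∘ bm_base t
  by rewrite comp_idl comp_idr.
exists e; rewrite exchE /=.
apply: (@iso_to_inj_r _ _ _ _ (pull_id Bun (fibre X))).
rewrite iso_fromK_r -fib_assoc -pull_id_natural fib_assoc.
by rewrite -[X in X ∘ _]fib_assoc exch_id -fmap_comp iso_fromK fmap_id comp_idl.
Qed.

Lemma interface_sq_hcomp (X0 X1 X2 Y0 Y1 Y2 : grothendieck Bun)
    (t' : hom X1 X2) (b' : hom Y1 Y2) (t : hom X0 X1) (b : hom Y0 Y1)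
    (l : lens X0 Y0) (m : lens X1 Y1) (r : lens X2 Y2) :
  interface_sq t' b' m r -> interface_sq t b l m ->
  interface_sq (t' ∘ t) (b' ∘ b) l r.
Proof.
move=> [e' q'] [e q]; rewrite !exchE in q q'.
have e'' : bm_base b' ∘ bm_base b ∘ lens_get l = lens_get r ∘ (bm_base t' ∘ bm_base t)
  by rewrite -comp_assoc e comp_assoc e' comp_assoc.
exists e''; rewrite exchE /=; rewrite -fib_assoc q !fib_assoc.
rewrite -[X in X ∘ exch _ _]fib_assoc -fmap_comp q' !fmap_comp !fib_assoc.
rewrite pull_comp_natural -[X in X ∘ fmap (P (lens_get l)) _ = _]fib_assoc.
rewrite -exch_natural -[X in _ = X ∘ _ ∘ _]fib_assoc (exch_hcomp e e' e'').
by rewrite !fib_assoc.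
Qed.

Lemma interface_sq_vcomp (X0 X1 Y0 Y1 Z0 Z1 : grothendieck Bun)
    (t : hom X0 X1) (m : hom Y0 Y1) (b : hom Z0 Z1)
    (l' : lens Y0 Z0) (r' : lens Y1 Z1) (l : lens X0 Y0) (r : lens X1 Y1) :
  interface_sq m b l' r' -> interface_sq t m l r ->
  interface_sq t b (lens_comp l' l) (lens_comp r' r).
Proof.
move=> [e' q'] [e q]; rewrite !exchE in q q'.
have e'' : bm_base b ∘ (lens_get l' ∘ lens_get l)
    = lens_get r' ∘ lens_get r ∘ bm_base t
  by rewrite comp_assoc e' -comp_assoc e comp_assoc.
exists e''; rewrite exchE /=.
rewrite !fib_assoc q -[X in X ∘ iso_from _ = _]fib_assoc -fmap_comp q'.
rewrite !fmap_comp !fib_assoc -[X in X ∘ fmap _ (exch _ _)]fib_assoc exch_natural.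
rewrite !fib_assoc -[LHS]fib_assoc -pull2IE pull2I_natural pull2IE !fib_assoc.
rewrite -[X in _ = X ∘ _]fib_assoc -(exch_vcomp e e' e'').
by rewrite !fib_assoc.
Qed.

Lemma lens_compE (X Y Z : bundle Bun) (h : lens Y Z) (f : lens X Y)
    (k : hom (base X) (base Z)) (e : lens_get h ∘ lens_get f = k) :
  lens_comp h f = @Lens C Bun X Z k
    (lens_put f ∘ fmap (P (lens_get f)) (lens_put h) ∘ iso_from (pull2 e (fibre Z))).
Proof. by case: k / e; rewrite pull2IE. Qed.

Lemma lens_compA (X Y Z W : bundle Bun) (h : lens Z W) (g : lens Y Z) (f : lens X Y) :
  lens_comp h (lens_comp g f) = lens_comp (lens_comp h g) f.
Proof.
rewrite (lens_compE (h := h) (f := lens_comp g f) (comp_assoc _ _ _)).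
congr Lens; rewrite /= -pull2IE -[iso_from (pull_comp _ (lens_get h) _ _)]pull2IE.
rewrite -[iso_from (pull_comp _ (_ ∘ _) _ _)]pull2IE !fmap_comp !fib_assoc.
rewrite -[X in X ∘ iso_from (pull2 (comp_assoc _ _ _) _)]fib_assoc.
rewrite -pull2I_natural -!fib_assoc; do 3 congr (_ ∘ _).
exact: pull2I_assoc.
Qed.

Lemma lens_comp_idl (X Y : bundle Bun) (f : lens X Y) : lens_comp (lens_id Y) f = f.
Proof.
rewrite (lens_compE (h := lens_id Y) (comp_idl (lens_get f))) /=.
case: f => [f p] /=; congr Lens; rewrite -fib_assoc -[RHS]comp_idr; congr (_ ∘ _).
apply: (@iso_to_inj_r _ _ _ _ (pull2 (comp_idl f) (fibre Y))).
rewrite iso_fromK_r comp_idl.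
apply: (@iso_to_inj_r _ _ _ _ (fmap_iso (P f) (pull_id Bun (fibre Y)))).
by rewrite /= -fmap_comp iso_fromK fmap_id -pull0E pull2_unitl.
Qed.

Lemma lens_comp_idr (X Y : bundle Bun) (f : lens X Y) : lens_comp f (lens_id X) = f.
Proof.
rewrite (lens_compE (f := lens_id X) (comp_idr (lens_get f))) /=.
case: f => [f p] /=; congr Lens.
apply: (@iso_to_inj_r _ _ _ _ (pull2 (comp_idr f) (fibre Y))).
apply: (@iso_to_inj_r _ _ _ _ (pull0 (erefl (idm (base X))) (P f (fibre Y)))).
rewrite iso_fromK_r -fib_assoc pull0E -pull_id_natural fib_assoc iso_fromK comp_idl.
by rewrite -fib_assoc -pull0E pull2_unitr comp_idr.
Qed.

Definition interface_data : double_data :=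
  @DoubleData (grothendieck Bun) (@lens C Bun) (@lens_id C Bun) (@lens_comp C Bun)
    (@interface_sq C Bun) interface_sq_hid interface_sq_hcomp interface_sq_vid
    interface_sq_vcomp.

Lemma interface_sq_eq (A B A' B' : interface_data) (l : vhom A A') (r : vhom B B')
    (t t' : hom A B) (b b' : hom A' B') (s : sq t b l r) (s' : sq t' b' l r) :
  t = t' -> b = b' -> s ≡ s'.
Proof.
move=> et; case: t' / et s' => s' eb; case: b' / eb s' => s'.
by congr sq_total; apply: (proof_irrelevance (interface_sq t b l r)).
Qed.

Lemma interface_sq_lens_eq (X Y : grothendieck Bun) (f f' : lens X Y) :
  f = f' -> interface_sq (idm X) (idm Y) f f'.
Proof. by move=> <-; apply: interface_sq_hid. Qed.

Definition interface_globular (A B : interface_data) (f f' : vhom A B) (e : f = f') :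
    globular_iso f f' :=
  @GlobularIso interface_data A B f f' (interface_sq_lens_eq e)
    (interface_sq_lens_eq (eq_sym e))
    (interface_sq_eq _ _ (comp_idl _) (comp_idl _))
    (interface_sq_eq _ _ (comp_idl _) (comp_idl _)).

Program Definition Interface : double_category :=
  @DoubleCategory interface_data _ _ _ _ _ _ _
    (fun X Y Z W h g f => interface_globular (lens_compA h g f))
    (fun X Y f => interface_globular (lens_comp_idl f))
    (fun X Y f => interface_globular (lens_comp_idr f)) _ _ _ _ _.
Solve Obligations with
  move=> *; first
    [ by apply: (proof_irrelevance (interface_sq _ _ _ _))
    | by apply: interface_sq_eq; rewrite ?comp_idl ?comp_idr ?comp_assoc ].

End Interface.

(** The splitting is built in: a section of the projection from the Grothendieck construction: a functor
    [S |-> (TS over S)], [φ |-> (Tφ over φ)]. *)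
Record bundle_section (C : category) (Bun : indexed_category C) := BundleSection {
  sec_ob :> forall S : C, Bun S;
  sec_mor : forall (S S' : C) (φ : hom S S'),
    hom (sec_ob S) (pull Bun φ (sec_ob S'));
  sec_id : forall S : C,
    @BundleMap C Bun (Bundle (sec_ob S)) (Bundle (sec_ob S)) (idm S) (sec_mor (idm S))
      = bundle_map_id (Bundle (sec_ob S));
  sec_comp : forall (S S' S'' : C) (ψ : hom S' S'') (φ : hom S S'),
    @BundleMap C Bun (Bundle (sec_ob S)) (Bundle (sec_ob S'')) (ψ ∘ φ) (sec_mor (ψ ∘ φ))
      = bundle_map_comp
          (@BundleMap C Bun (Bundle (sec_ob S')) (Bundle (sec_ob S'')) ψ (sec_mor ψ))
          (@BundleMap C Bun (Bundle (sec_ob S)) (Bundle (sec_ob S')) φ (sec_mor φ))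
}.
Arguments sec_mor {C Bun} _ {S S'} φ.

Definition section_functor (C : category) (Bun : indexed_category C)
    (T : bundle_section Bun) : functor C (grothendieck Bun) :=
  @Functor C (grothendieck Bun) (fun S => Bundle (T S))
    (fun S S' φ => @BundleMap C Bun (Bundle (T S)) (Bundle (T S')) φ (sec_mor T φ))
    (@sec_id C Bun T) (@sec_comp C Bun T).

Record system (C : category) (Bun : indexed_category C) (T : bundle_section Bun)
    (X : bundle Bun) := System {
  state : C;
  dynamics : lens (section_functor T state) X
}.

(** [φ] is a covariant morphism over the bundle map [g]. *)
Definition covariant (C : category) (Bun : indexed_category C) (T : bundle_section Bun)
    (X Y : bundle Bun) (g : bundle_map X Y) (x : system T X) (y : system T Y)
    (φ : hom (state x) (state y)) : Prop :=
  interface_sq (fmap (section_functor T) φ) g (dynamics x) (dynamics y).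

Definition system_over (C : category) (Bun : indexed_category C)
    (T : bundle_section Bun) (X Y : bundle Bun) (g : bundle_map X Y)
    (x : system T X) (y : system T Y) : Type :=
  {φ : hom (state x) (state y) | covariant g φ}.

(** All systems, with covariant morphisms over arbitrary bundle maps. *)
Record any_system (C : category) (Bun : indexed_category C) (T : bundle_section Bun) :=
    AnySystem {
  any_interface : bundle Bun;
  any_dynamics :> system T any_interface
}.

Section Dyn.
Variables (C : category) (Bun : indexed_category C) (T : bundle_section Bun).

Lemma covariant_id (X : bundle Bun) (x : system T X) :
  covariant (bundle_map_id X) (idm (state x)).
Proof. by rewrite /covariant fmap_id; apply: interface_sq_hid. Qed.

Lemma covariant_comp (X Y Z : bundle Bun) (h : bundle_map Y Z) (g : bundle_map X Y)
    (x : system T X) (y : system T Y) (z : system T Z)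
    (ψ : hom (state y) (state z)) (φ : hom (state x) (state y)) :
  covariant h ψ -> covariant g φ -> covariant (bundle_map_comp h g) (ψ ∘ φ).
Proof.
rewrite /covariant fmap_comp => s' s.
exact: (@interface_sq_hcomp C Bun _ _ _ _ _ _ _ _ _ _ _ _ _ s' s).
Qed.

Lemma covariant_comp_idl (X Y : grothendieck Bun) (g : hom X Y)
    (x : system T X) (y z : system T Y)
    (ψ : hom (state y) (state z)) (φ : hom (state x) (state y)) :
  covariant (bundle_map_id Y) ψ -> covariant g φ -> covariant g (ψ ∘ φ).
Proof.
move=> s' s; rewrite -(comp_idl g).
exact: covariant_comp s' s.
Qed.

Lemma covariant_comp_idr (X Y : grothendieck Bun) (g : hom X Y)
    (x y : system T X) (z : system T Y)
    (ψ : hom (state y) (state z)) (φ : hom (state x) (state y)) :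
  covariant g ψ -> covariant (bundle_map_id X) φ -> covariant g (ψ ∘ φ).
Proof.
move=> s' s; rewrite -(comp_idr g).
exact: covariant_comp s' s.
Qed.

Lemma system_over_eq (X Y : bundle Bun) (g : bundle_map X Y) (x : system T X)
    (y : system T Y) (φ ψ : system_over g x y) :
  proj1_sig φ = proj1_sig ψ -> φ = ψ.
Proof. exact: sig_eq. Qed.

Lemma system_over_total_eq (X Y : bundle Bun) (x : system T X) (y : system T Y)
    (g h : bundle_map X Y) (φ : system_over g x y) (ψ : system_over h x y) :
  g = h -> proj1_sig φ = proj1_sig ψ ->
  existT (fun g => system_over g x y) g φ = existT _ h ψ.
Proof. by move=> e; case: h / e ψ => ψ e; rewrite (system_over_eq e). Qed.

Program Definition hDyn : category :=
  @Category (any_system T)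
    (fun x y => {g : bundle_map (any_interface x) (any_interface y) & system_over g x y})
    (fun x => existT _ (bundle_map_id (any_interface x))
       (exist _ (idm (state x)) (covariant_id x)))
    (fun x y z h g => existT _ (bundle_map_comp (projT1 h) (projT1 g))
       (exist _ (proj1_sig (projT2 h) ∘ proj1_sig (projT2 g))
          (covariant_comp (proj2_sig (projT2 h)) (proj2_sig (projT2 g))))) _ _ _.
Next Obligation.
move=> x y [g φ]; apply: system_over_total_eq => /=; last exact: comp_idl.
exact: (@comp_idl (grothendieck Bun)).
Qed.
Next Obligation.
move=> x y [g φ]; apply: system_over_total_eq => /=; last exact: comp_idr.
exact: (@comp_idr (grothendieck Bun)).
Qed.
Next Obligation.
move=> x y z w [k κ] [h ψ] [g φ]; apply: system_over_total_eq => /=; last exact: comp_assoc.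
exact: (@comp_assoc (grothendieck Bun)).
Qed.

Program Definition dyn_category (X : bundle Bun) : category :=
  @Category (system T X) (fun x y => system_over (bundle_map_id X) x y)
    (fun x => exist _ (idm (state x)) (covariant_id x))
    (fun x y z ψ φ => exist _ (proj1_sig ψ ∘ proj1_sig φ)
       (covariant_comp_idl (proj2_sig ψ) (proj2_sig φ))) _ _ _.
Next Obligation. by move=> *; apply: system_over_eq; apply: comp_idl. Qed.
Next Obligation. by move=> *; apply: system_over_eq; apply: comp_idr. Qed.
Next Obligation. by move=> *; apply: system_over_eq; apply: comp_assoc. Qed.

Definition system_comp (X Y : bundle Bun) (f : lens X Y) (x : system T X) :
    system T Y :=
  System (lens_comp f (dynamics x)).

Lemma covariant_vcomp (X Y X' Y' : bundle Bun) (g : bundle_map X Y)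
    (g' : bundle_map X' Y') (l : lens X X') (r : lens Y Y')
    (x : system T X) (y : system T Y) (φ : hom (state x) (state y)) :
  interface_sq g g' l r -> covariant g φ ->
  covariant (x := system_comp l x) (y := system_comp r y) g' φ.
Proof. exact: interface_sq_vcomp. Qed.

Definition dyn_sq (X Y X' Y' : bundle Bun) (g : bundle_map X Y)
    (g' : bundle_map X' Y') (l : lens X X') (r : lens Y Y')
    (s : interface_sq g g' l r) (x : system T X) (y : system T Y)
    (φ : system_over g x y) :
    system_over g' (system_comp l x) (system_comp r y) :=
  exist _ (proj1_sig φ) (covariant_vcomp s (proj2_sig φ)).

Program Definition dyn_lens (X Y : bundle Bun) (f : lens X Y) :
    functor (dyn_category X) (dyn_category Y) :=
  @Functor (dyn_category X) (dyn_category Y) (system_comp f)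
    (fun x y φ => dyn_sq (interface_sq_hid f) φ) _ _.
Next Obligation. by move=> *; apply: system_over_eq. Qed.
Next Obligation. by move=> *; apply: system_over_eq. Qed.

Program Definition dyn_profunctor (X Y : grothendieck Bun) (g : hom X Y) :
    profunctor (dyn_category X) (dyn_category Y) :=
  @Profunctor (dyn_category X) (dyn_category Y) (system_over g)
    (fun x' x y φ p => exist _ (proj1_sig p ∘ proj1_sig φ)
       (covariant_comp_idr (proj2_sig p) (proj2_sig φ)))
    (fun x y y' φ p => exist _ (proj1_sig φ ∘ proj1_sig p)
       (covariant_comp_idl (proj2_sig φ) (proj2_sig p))) _ _ _ _ _.
Next Obligation. by move=> *; apply: system_over_eq; apply: comp_idr. Qed.
Next Obligation. by move=> *; apply: system_over_eq; apply: comp_assoc. Qed.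
Next Obligation. by move=> *; apply: system_over_eq; apply: comp_idl. Qed.
Next Obligation.
by move=> *; apply: system_over_eq; apply: eq_sym; apply: comp_assoc.
Qed.
Next Obligation.
by move=> *; apply: system_over_eq; apply: eq_sym; apply: comp_assoc.
Qed.

Definition dyn_lax (X Y Z : bundle Bun) (g : bundle_map X Y) (h : bundle_map Y Z)
    (x : system T X) (y : system T Y) (z : system T Z)
    (φ : system_over g x y) (ψ : system_over h y z) :
    system_over (bundle_map_comp h g) x z :=
  exist _ (proj1_sig ψ ∘ proj1_sig φ) (covariant_comp (proj2_sig ψ) (proj2_sig φ)).

Lemma covariant_eq (X : bundle Bun) (S : C) (l l' : lens (section_functor T S) X) :
  l = l' -> interface_sq (fmap (section_functor T) (idm S)) (bundle_map_id X) l l'.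
Proof. by move=> <-; rewrite fmap_id; apply: interface_sq_hid. Qed.

Program Definition dyn_vid (X : bundle Bun) (x : dyn_category X) :
    iso x (dyn_lens (lens_id X) x) :=
  @Iso (dyn_category X) x (dyn_lens (lens_id X) x)
    (exist _ (idm (state x)) (covariant_eq (eq_sym (lens_comp_idl (dynamics x)))))
    (exist _ (idm (state x)) (covariant_eq (lens_comp_idl (dynamics x)))) _ _.
Next Obligation. by move=> *; apply: system_over_eq; apply: comp_idl. Qed.
Next Obligation. by move=> *; apply: system_over_eq; apply: comp_idl. Qed.

Program Definition dyn_vcomp (X Y Z : bundle Bun) (g : lens Y Z) (f : lens X Y)
    (x : dyn_category X) :
    iso (dyn_lens g (dyn_lens f x)) (dyn_lens (lens_comp g f) x) :=
  @Iso (dyn_category Z) (dyn_lens g (dyn_lens f x)) (dyn_lens (lens_comp g f) x)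
    (exist _ (idm (state x)) (covariant_eq (lens_compA g f (dynamics x))))
    (exist _ (idm (state x)) (covariant_eq (eq_sym (lens_compA g f (dynamics x))))) _ _.
Next Obligation. by move=> *; apply: system_over_eq; apply: comp_idl. Qed.
Next Obligation. by move=> *; apply: system_over_eq; apply: comp_idl. Qed.

Definition dyn_data : indexed_data (Interface Bun) :=
  @IndexedData (Interface Bun) dyn_category dyn_lens dyn_profunctor dyn_sq
    (fun X x y φ => φ) dyn_lax dyn_vid dyn_vcomp.

Program Definition Dyn : indexed_double_category (Interface Bun) :=
  @IndexedDoubleCategory (Interface Bun) dyn_data
    _ _ _ _ _ _ _ _ _ _ _ _ _ _ _ _ _ _ _.
Solve Obligations with
  move=> *; first
    [ by apply: system_over_eq; rewrite /= ?comp_idl ?comp_idr ?comp_assoc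
    | by apply: system_over_total_eq; rewrite /= ?comp_idl ?comp_idr ?comp_assoc
    | idtac ].
Next Obligation.
move=> X Y Z W g h k x y z w φ ψ κ; apply: system_over_total_eq; last exact: comp_assoc.
exact: (@comp_assoc (grothendieck Bun)).
Qed.
Next Obligation.
move=> X Y g x' x y φ ψ; apply: system_over_total_eq; last by [].
exact: (@comp_idr (grothendieck Bun)).
Qed.
Next Obligation.
move=> X Y g x y y' φ ψ; apply: system_over_total_eq; last by [].
exact: (@comp_idl (grothendieck Bun)).
Qed.

End Dyn.

Section Represented.
Variables (C : category) (Bun : indexed_category C).

(** A lens as a span with vertical left leg and cartesian right leg. *)
Definition lens_span (X Y : grothendieck Bun) (f : lens X Y) : span X Y :=
  @Span (grothendieck Bun) X Y (Bundle (pull Bun (lens_get f) (fibre Y)))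
    (@BundleMap C Bun (Bundle (pull Bun (lens_get f) (fibre Y))) X (idm (base X))
       (iso_to (pull_id Bun (fibre X)) ∘ lens_put f))
    (@BundleMap C Bun (Bundle (pull Bun (lens_get f) (fibre Y))) Y (lens_get f)
       (idm (pull Bun (lens_get f) (fibre Y)))).

Lemma vertical_comp_l (X Z : bundle Bun) (A : Bun (base X)) (p : hom A (fibre X))
    (m : bundle_map Z (Bundle A)) :
  bundle_map_comp
    (@BundleMap C Bun (Bundle A) X (idm (base X)) (iso_to (pull_id Bun (fibre X)) ∘ p)) m
  = @BundleMap C Bun Z X (bm_base m) (fmap (pull Bun (bm_base m)) p ∘ bm_fib m).
Proof.
apply: (@bundle_map_eq C Bun Z X (bundle_map_comp (BundleMap (X := Bundle A) _) m)
  (BundleMap (X := Z) _) (comp_idl (bm_base m))) => /=.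
by rewrite fmap_comp !fib_assoc pull_unitl comp_idl.
Qed.

Lemma vertical_comp_r (X Z : bundle Bun) (A : Bun (base X)) (p : hom A (fibre X))
    (m : bundle_map X Z) :
  bundle_map_comp m
    (@BundleMap C Bun (Bundle A) X (idm (base X)) (iso_to (pull_id Bun (fibre X)) ∘ p))
  = @BundleMap C Bun (Bundle A) Z (bm_base m) (bm_fib m ∘ p).
Proof.
apply: (@bundle_map_eq C Bun (Bundle A) Z (bundle_map_comp m (BundleMap (X := Bundle A) _))
  (BundleMap (X := Bundle A) _) (comp_idr (bm_base m))) => /=.
rewrite !fib_assoc -[X in X ∘ p = _]fib_assoc -pull_id_natural.
by rewrite !fib_assoc pull_unitr comp_idl.
Qed.

Lemma interface_sq_base (X1 X2 X3 X4 : bundle Bun) (t : bundle_map X1 X2)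
    (b : bundle_map X3 X4) (l : lens X1 X3) (r : lens X2 X4) :
  interface_sq t b l r -> bm_base b ∘ lens_get l = lens_get r ∘ bm_base t.
Proof. by case. Qed.

Section LensSpanMap.
Variables (X1 X2 X3 X4 : grothendieck Bun) (t : hom X1 X2) (b : hom X3 X4).
Variables (l : lens X1 X3) (r : lens X2 X4) (s : interface_sq t b l r).

Definition lens_span_mor : hom (apex (lens_span l)) (apex (lens_span r)) :=
  @BundleMap C Bun (apex (lens_span l)) (apex (lens_span r)) (bm_base t)
    (exchange (interface_sq_base s) (fibre X4)
       ∘ fmap (pull Bun (lens_get l)) (bm_fib b)).

Lemma lens_span_mor_l : span_l (lens_span r) ∘ lens_span_mor = t ∘ span_l (lens_span l).
Proof.
rewrite /= vertical_comp_l vertical_comp_r; congr BundleMap.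
case: (s) => e /= ->; rewrite (proof_irrelevance _ (interface_sq_base s) e).
by rewrite fib_assoc.
Qed.

Lemma lens_span_mor_r : span_r (lens_span r) ∘ lens_span_mor = b ∘ span_r (lens_span l).
Proof.
apply: (@bundle_map_eq C Bun _ _ (bundle_map_comp (span_r (lens_span r)) lens_span_mor)
  (bundle_map_comp b (span_r (lens_span l))) (eq_sym (interface_sq_base s))) => /=.
rewrite fmap_id !comp_idr exchE.
rewrite (exch_pull2 _ (@eq_refl _ _) (eq_sym (interface_sq_base s))).
by rewrite !fib_assoc -pull2_toE iso_toK comp_idl pull2E.
Qed.

Definition lens_span_map : span_map t b (lens_span l) (lens_span r) :=
  SpanMap lens_span_mor_l lens_span_mor_r.

End LensSpanMap.

Definition representable_data (X : grothendieck Bun) :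
    double_functor_data (Interface Bun) SpanSets :=
  @DoubleFunctorData (Interface Bun) SpanSets (representable X)
    (@fmap _ _ (representable X))
    (fun Y Z f => fmap_span (representable X) (lens_span f))
    (fun Y Z Y' Z' t b l r s => fmap_span_map (representable X) (lens_span_map s)).

Variables (T : bundle_section Bun).

Lemma hDyn_comp_over (x : any_system T) (X : grothendieck Bun) (y z : system T X)
    (φ : system_over (bundle_map_id X) y z) (m : @hom (hDyn T) x (AnySystem y)) :
  projT1 ((existT _ (bundle_map_id X) φ : @hom (hDyn T) (AnySystem y) (AnySystem z)) ∘ m)
    = projT1 m.
Proof. exact: (@comp_idl (grothendieck Bun)). Qed.

Definition hDyn_data (x : any_system T) :
    transformation_data (Dyn T) SliceSets (representable_data (any_interface x)) :=
  @TransformationData (Interface Bun) SpanSets (Dyn T) SliceSets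
    (representable_data (any_interface x))
    (fun X y => @SliceOb Sets (hom (any_interface x : grothendieck Bun) X)
       (@hom (hDyn T) x (AnySystem y)) (fun m => projT1 m))
    (fun X y z φ => exist _
       (fun m : @hom (hDyn T) x (AnySystem y) =>
          (existT _ (bundle_map_id X) φ : @hom (hDyn T) (AnySystem y) (AnySystem z)) ∘ m)
       (functional_extensionality _ _ (hDyn_comp_over φ)))
    (fun X Y g y z φ => exist _
       (fun m : @hom (hDyn T) x (AnySystem y) =>
          (existT _ g φ : @hom (hDyn T) (AnySystem y) (AnySystem z)) ∘ m)
       eq_refl).

(** The readout is the identity; [u] is transported along [id^* I ≅ I]. *)
Definition exposing_system (S : C) (I : Bun S) (u : hom I (T S)) : any_system T :=
  AnySystem (any_interface := Bundle I) (System (state := S)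
    (@Lens C Bun (Bundle (T S)) (Bundle I) (idm S) (u ∘ iso_from (pull_id Bun I)))).

End Represented.

(* Main.v *)
(** A lens [f : X <-> Y] is a span in [∫Bun] whose right leg is cartesian, so a
    map into its apex is determined by its base map and its composite with the
    right leg.  Hence the span of a composite lens is the pullback of the two
    spans, which gives the vertical comparison of the representable double
    functor; every coherence law reduces to the uniqueness of cartesian lifts.
    As the representing system exposes its state, a covariant morphism from it
    to [y] is the same as a map [q] from [I] over [S] into the apex of the span
    of [y] whose left component is [Tφ ∘ u]; its bundle map is the right
    component of [q].  So composing [y] with a lens amounts to pulling back along
    the left leg of its span. *)

Require Import Defs.
From Stdlib Require Import ssreflect FunctionalExtensionality ProofIrrelevance.

Set Implicit Arguments.
Unset Strict Implicit.
Unset Printing Implicit Defensive.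

(** * Cartesian lifts along right legs of lens spans, and spans of composite lenses *)

Section LensSpans.
Variables (C : category) (Bun : indexed_category C).
Local Notation G := (grothendieck Bun).
Local Notation P f := (lens_span f).

Lemma bm_base_comp (X Y Z : G) (h : hom Y Z) (g : hom X Y) :
  bm_base (h ∘ g) = bm_base h ∘ bm_base g.
Proof. by []. Qed.

(** The type of the fibre component depends on the base map; cancelling the shared base uses
    uniqueness of identity proofs, which follows from proof irrelevance. *)
Lemma bundle_map_fib_inj (X Y : bundle Bun) (k : hom (base X) (base Y))
    (a b : hom (fibre X) (pull Bun k (fibre Y))) :
  BundleMap a = BundleMap b -> a = b.
Proof.
move=> e.
exact: inj_pair2 (f_equal (fun g => existT (fun k => hom _ (pull Bun k _)) _ (bm_fib g)) e).
Qed.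

Lemma cartesian_comp (X Y W : G) (f : lens X Y) (m : hom W (apex (P f))) :
  span_r (P f) ∘ m =
    @BundleMap C Bun W Y (lens_get f ∘ bm_base m)
      (iso_to (pull_comp Bun (lens_get f) (bm_base m) (fibre Y)) ∘ bm_fib m).
Proof. by rewrite /= /bundle_map_comp /= fmap_id comp_idr. Qed.

(** The uniqueness half of cartesianness: the fibre component of the right leg is an identity, so
    composing with it only applies a comparison isomorphism, which cancels. *)
Lemma cartesian_ext (X Y W : G) (f : lens X Y) (m m' : hom W (apex (P f))) :
  bm_base m = bm_base m' -> span_r (P f) ∘ m = span_r (P f) ∘ m' -> m = m'.
Proof.
rewrite !cartesian_comp; case: m m' => [k a] [k' a'] /= e.
case: k' / e a' => a' /bundle_map_fib_inj e.
by congr BundleMap; apply: iso_to_inj e.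
Qed.

(** The existence half. The base of [h] equals [lens_get f ∘ k] only propositionally, hence
    [pull2 e] instead of [pull_comp]. *)
Definition cartesian_lift (X Y W : G) (f : lens X Y) (h : hom W Y)
    (k : hom (base W) (base X)) (e : lens_get f ∘ k = bm_base h) :
    hom W (apex (P f)) :=
  @BundleMap C Bun W (apex (P f)) k (iso_from (pull2 e (fibre Y)) ∘ bm_fib h).

Lemma cartesian_liftK (X Y W : G) (f : lens X Y) (h : hom W Y)
    (k : hom (base W) (base X)) (e : lens_get f ∘ k = bm_base h) :
  span_r (P f) ∘ cartesian_lift e = h.
Proof.
rewrite cartesian_comp; case: h e => h a /= e; case: h / e a => a /=.
by rewrite -pull2E fib_assoc iso_toK comp_idl.
Qed.

(** The put of the identity lens is the inverse of [pull_id], so the fibre component of the left leg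
    collapses to an identity. *)
Lemma lens_span_id (X : G) : span_l (P (lens_id X)) = span_r (P (lens_id X)).
Proof. by rewrite /= iso_toK. Qed.

Lemma span_l_base (X Y W : G) (f : lens X Y) (m : hom W (apex (P f))) :
  bm_base (span_l (P f) ∘ m) = bm_base m.
Proof. exact: comp_idl. Qed.

Lemma span_r_base (X Y W : G) (f : lens X Y) (m : hom W (apex (P f))) :
  bm_base (span_r (P f) ∘ m) = lens_get f ∘ bm_base m.
Proof. by []. Qed.

Section Composite.
Variables (X Y Z : G) (g : lens Y Z) (f : lens X Y).

(** The fibre component is [lens_put (lens_comp g f)] without its final factor [lens_put f], made
    vertical by [pull_id]. *)
Definition lens_comp_fst : hom (apex (P (lens_comp g f))) (apex (P f)) :=
  @BundleMap C Bun (Bundle (pull Bun (lens_get g ∘ lens_get f) (fibre Z)))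
    (Bundle (pull Bun (lens_get f) (fibre Y))) (idm (base X))
    (iso_to (pull_id Bun _)
       ∘ (fmap (pull Bun (lens_get f)) (lens_put g)
            ∘ iso_from (pull_comp Bun (lens_get g) (lens_get f) (fibre Z)))).

Definition lens_comp_snd : hom (apex (P (lens_comp g f))) (apex (P g)) :=
  @cartesian_lift _ _ _ g (span_r (P (lens_comp g f))) (lens_get f) eq_refl.

Lemma lens_comp_fst_l :
  span_l (P f) ∘ lens_comp_fst = span_l (P (lens_comp g f)).
Proof.
rewrite /= vertical_comp_l /=; congr BundleMap.
by rewrite !fib_assoc -pull_id_natural.
Qed.

Lemma lens_comp_snd_r :
  span_r (P g) ∘ lens_comp_snd = span_r (P (lens_comp g f)).
Proof. exact: cartesian_liftK. Qed.

Lemma lens_comp_square :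
  span_r (P f) ∘ lens_comp_fst = span_l (P g) ∘ lens_comp_snd.
Proof.
rewrite /= vertical_comp_l (@vertical_comp_r _ _ (Bundle (pull Bun (lens_get f) (fibre Y)))).
by rewrite /= comp_idl comp_idr pull2IE.
Qed.

(** The square forces the base of [q] to be [lens_get f] after that of [p]; [cartesian_ext] then
    settles [q] and, through the square, [p]. *)
Lemma lens_comp_unique (W : G) (p : hom W (apex (P f))) (q : hom W (apex (P g)))
    (n : hom W (apex (P (lens_comp g f)))) :
  bm_base n = bm_base p -> span_r (P f) ∘ p = span_l (P g) ∘ q ->
  span_r (P (lens_comp g f)) ∘ n = span_r (P g) ∘ q ->
  lens_comp_fst ∘ n = p /\ lens_comp_snd ∘ n = q.
Proof.
move=> ek epq en.
have eq : lens_comp_snd ∘ n = q.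
  apply: cartesian_ext; last by rewrite (@comp_assoc G) lens_comp_snd_r.
  rewrite bm_base_comp /= ek.
  by rewrite -span_r_base epq span_l_base.
split=> //; apply: cartesian_ext; first exact: eq_trans (comp_idl _) ek.
by rewrite comp_assoc lens_comp_square -comp_assoc eq.
Qed.

Lemma lens_comp_pair_base (W : G) (p : hom W (apex (P f))) (q : hom W (apex (P g))) :
  span_r (P f) ∘ p = span_l (P g) ∘ q ->
  lens_get (lens_comp g f) ∘ bm_base p = bm_base (span_r (P g) ∘ q).
Proof.
move=> e; rewrite span_r_base -(span_l_base q) -e.
by rewrite /= comp_assoc.
Qed.

Definition lens_comp_pair (W : G) (p : hom W (apex (P f))) (q : hom W (apex (P g)))
    (e : span_r (P f) ∘ p = span_l (P g) ∘ q) : hom W (apex (P (lens_comp g f))) :=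
  cartesian_lift (lens_comp_pair_base e).

Lemma lens_comp_pairE (W : G) (p : hom W (apex (P f))) (q : hom W (apex (P g)))
    (e : span_r (P f) ∘ p = span_l (P g) ∘ q) :
  lens_comp_fst ∘ lens_comp_pair e = p /\ lens_comp_snd ∘ lens_comp_pair e = q.
Proof. by apply: lens_comp_unique => //; apply: cartesian_liftK. Qed.

End Composite.
End LensSpans.

(** Boundaries of squares often agree only up to the functor laws of post-composition, so they vary
    here and are eliminated before apex maps are compared. *)
Lemma span_sq_ext (A B A' B' : SpanSets) (l : vhom A A') (r : vhom B B')
    (t t' : hom A B) (b b' : hom A' B') (s : sq t b l r) (s' : sq t' b' l r) :
  t = t' -> b = b' -> (forall z, span_mor s z = span_mor s' z) -> s ≡ s'.
Proof.
move=> et; case: t' / et s' => s' eb; case: b' / eb s' => s'.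
exact: span_sq_total_eq.
Qed.

Lemma slice_ix_ext (A B : SpanSets) (f f' : hom A B) (x : slice A) (y : slice B)
    (k : ix_hor SliceSets f x y) (k' : ix_hor SliceSets f' x y) :
  f = f' -> (forall z, proj1_sig k z = proj1_sig k' z) -> k ≈ k'.
Proof. by move=> ef; case: f' / ef k' => k'; apply: slice_ix_total_eq. Qed.

(** * The representable double functor into spans of sets *)

Section RepresentableDoubleFunctor.
Variables (C : category) (Bun : indexed_category C) (X : grothendieck Bun).
Local Notation G := (grothendieck Bun).
Local Notation P f := (lens_span f).
Local Notation K := (representable_data X).

Section Unit.
Variable A : G.

Definition rep_vid_to :
    @sq SpanSets _ _ _ _ (idm (K A)) (idm (K A)) (vid (K A)) (df_ver K (@vid (Interface Bun) A)).
Proof.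
refine (@SpanMap Sets _ _ _ _ (idm (K A)) (idm (K A)) (span_id (K A))
  (df_ver K (@vid (Interface Bun) A))
  (fun m : hom X A => @cartesian_lift C Bun _ _ X (lens_id A) m (bm_base m) (comp_idl _)) _ _);
  apply: functional_extensionality => m /=.
(* The left-leg condition reduces to the right-leg one, since the two legs of the identity lens
   coincide. *)
- rewrite -[RHS](cartesian_liftK (f := lens_id A) (comp_idl (bm_base m))).
  by rewrite -lens_span_id.
- exact: (cartesian_liftK (f := lens_id A)).
Defined.

Definition rep_vid_from :
    @sq SpanSets _ _ _ _ (idm (K A)) (idm (K A)) (df_ver K (@vid (Interface Bun) A)) (vid (K A)).
Proof.
refine (@SpanMap Sets _ _ _ _ (idm (K A)) (idm (K A))
  (df_ver K (@vid (Interface Bun) A)) (span_id (K A))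
  (fun n : hom X (apex (P (lens_id A))) => span_r (P (lens_id A)) ∘ n) _ _).
- apply: functional_extensionality => n.
  by change (span_r (P (lens_id A)) ∘ n = span_l (P (lens_id A)) ∘ n); rewrite lens_span_id.
- by [].
Defined.

Definition rep_vid : @globular_iso SpanSets _ _ (vid (K A)) (df_ver K (@vid (Interface Bun) A)).
Proof.
refine (@GlobularIso SpanSets _ _ _ _ rep_vid_to rep_vid_from _ _).
- by apply: span_sq_ext => // m; apply: (cartesian_liftK (f := lens_id A)).
- apply: span_sq_ext => // n; apply: cartesian_ext; first exact: comp_idl.
  exact: (cartesian_liftK (f := lens_id A)).
Defined.
End Unit.

Section Comp.
Variables (A B D : G) (g : lens B D) (f : lens A B).
Local Notation Kf := (df_ver K (f : @vhom (Interface Bun) A B)).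
Local Notation Kg := (df_ver K (g : @vhom (Interface Bun) B D)).
Local Notation Kgf := (df_ver K (@vcomp (Interface Bun) _ _ _ g f)).

Lemma rep_vcomp_square (n : apex Kgf) :
  span_r (P f) ∘ (lens_comp_fst g f ∘ n) = span_l (P g) ∘ (lens_comp_snd g f ∘ n).
Proof. by rewrite !comp_assoc lens_comp_square. Qed.

Definition rep_vcomp_to :
    @sq SpanSets _ _ _ _ (idm (K A)) (idm (K D)) (vcomp Kg Kf) Kgf.
Proof.
refine (@SpanMap Sets _ _ _ _ (idm (K A)) (idm (K D)) (span_comp Kg Kf) Kgf
  (fun z => lens_comp_pair (pb_eq z)) _ _); apply: functional_extensionality => z.
- rewrite [LHS]/= -[X in X ∘ _ = _]lens_comp_fst_l -comp_assoc.
  by rewrite (proj1 (lens_comp_pairE (pb_eq z))).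
- exact: cartesian_liftK.
Defined.

Definition rep_vcomp_from :
    @sq SpanSets _ _ _ _ (idm (K A)) (idm (K D)) Kgf (vcomp Kg Kf).
Proof.
refine (@SpanMap Sets _ _ _ _ (idm (K A)) (idm (K D)) Kgf (span_comp Kg Kf)
  (fun n => @pb _ _ _ (span_r Kf) (span_l Kg) (lens_comp_fst g f ∘ n : apex Kf)
    (lens_comp_snd g f ∘ n) (rep_vcomp_square n)) _ _);
  apply: functional_extensionality => n.
- change (span_l (P f) ∘ (lens_comp_fst g f ∘ n) = span_l (P (lens_comp g f)) ∘ n).
  by rewrite comp_assoc lens_comp_fst_l.
- change (span_r (P g) ∘ (lens_comp_snd g f ∘ n) = span_r (P (lens_comp g f)) ∘ n).
  by rewrite comp_assoc lens_comp_snd_r.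
Defined.

Definition rep_vcomp : @globular_iso SpanSets _ _ (vcomp Kg Kf) Kgf.
Proof.
refine (@GlobularIso SpanSets _ _ _ _ rep_vcomp_to rep_vcomp_from _ _).
- by apply: span_sq_ext => // z; apply: pb_ext; case: (lens_comp_pairE (pb_eq z)).
- apply: span_sq_ext => // n; apply: cartesian_ext; first exact: comp_idl.
  rewrite [LHS]cartesian_liftK [pb2 _]/=.
  by rewrite comp_assoc lens_comp_snd_r.
Defined.
End Comp.

(** With [cartesian_liftK] for the comparison squares and [cartesian_ext], this reduces each
    coherence law to bases and right legs. *)
Lemma rep_sq_r (A B A' B' : G) (t : hom A B) (b : hom A' B')
    (l : lens A A') (r : lens B B') (s : interface_sq t b l r) (n : hom X (apex (P l))) :
  span_r (P r) ∘ (lens_span_mor s ∘ n) = b ∘ (span_r (P l) ∘ n).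
Proof. by rewrite comp_assoc lens_span_mor_r comp_assoc. Qed.

Program Definition representable_double : double_functor (Interface Bun) SpanSets :=
  @DoubleFunctor (Interface Bun) SpanSets K _ _ _ _ rep_vid rep_vcomp _ _ _ _ _.
Next Obligation. exact: (fmap_id (representable X)). Qed.
Next Obligation. exact: (fmap_comp (representable X)). Qed.
Next Obligation.
move=> A B v; apply: span_sq_ext; try exact: (fmap_id (representable X)).
move=> n; apply: cartesian_ext; first exact: comp_idl.
by apply: eq_trans (rep_sq_r _ _) _; apply: comp_idl.
Qed.
Next Obligation.
move=> A0 A1 A2 C0 C1 C2 t' b' t b l m r s' s.
apply: span_sq_ext; try exact: (fmap_comp (representable X)).
move=> n; apply: cartesian_ext; first by apply: eq_sym; apply: comp_assoc.
apply: eq_trans (rep_sq_r _ _) _.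
apply: eq_sym; apply: eq_trans (rep_sq_r _ _) _.
rewrite (rep_sq_r s n); exact: comp_assoc.
Qed.
Next Obligation.
move=> A B t; apply: span_sq_ext => // m.
apply: cartesian_ext => //.
rewrite (rep_sq_r _ _) (cartesian_liftK (f := lens_id _)).
congr (t ∘ _); apply: eq_sym; exact: (cartesian_liftK (f := lens_id _)).
Qed.
Next Obligation.
move=> A0 A1 B0 B1 C0 C1 t m b l' r' l r s' s; apply: span_sq_ext => // z.
apply: cartesian_ext => //.
apply: eq_trans (cartesian_liftK (f := lens_comp _ _) _) _.
apply: eq_trans (rep_sq_r _ _) _.
apply: eq_sym; apply: eq_trans (rep_sq_r _ _) _.
congr (b ∘ _).
exact: (cartesian_liftK (f := lens_comp _ _)).
Qed.
Next Obligation.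
move=> A B D E h g f; apply: span_sq_ext; try exact: (fmap_id (representable X)).
move=> z; apply: cartesian_ext; first exact: comp_idl.
apply: eq_trans (rep_sq_r _ _) _.
rewrite (@comp_idl G) (cartesian_liftK (f := lens_comp _ _)).
apply: eq_sym; apply: eq_trans (cartesian_liftK (f := lens_comp _ _) _) _.
exact: (cartesian_liftK (f := lens_comp _ _)).
Qed.
Next Obligation.
move=> A B f; apply: span_sq_ext; try exact: (fmap_id (representable X)).
move=> z; apply: cartesian_ext; first exact: comp_idl.
apply: eq_trans (rep_sq_r _ _) _.
rewrite (@comp_idl G) (cartesian_liftK (f := lens_comp _ _)).
apply: eq_trans (cartesian_liftK (f := lens_id _) _) _.
(* Over the identity span, the pullback equation says that [pb2 z] is the right leg of [P f] after
   [pb1 z]. *)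
exact: eq_sym (pb_eq z).
Qed.
Next Obligation.
move=> A B f; apply: span_sq_ext; try exact: (fmap_id (representable X)).
move=> z; apply: cartesian_ext.
(* The pair was lifted over the base of [pb1 z]; as the left leg is vertical, the pullback equation
   turns this into the base of [pb2 z]. *)
- apply: eq_trans (comp_idl _) _; rewrite -(span_l_base (pb2 z)).
  by rewrite -(pb_eq z : _ = span_l (P f) ∘ pb2 z).
- apply: eq_trans (rep_sq_r _ _) _; apply: eq_trans (comp_idl _) _.
  exact: (cartesian_liftK (f := lens_comp _ _)).
Qed.
End RepresentableDoubleFunctor.

(** * Covariant morphisms out of the state-exposing system *)

Section Covariance.
Variables (C : category) (Bun : indexed_category C) (T : bundle_section Bun).
Variables (S : C) (I : Bun S) (u : hom I (T S)).
Local Notation G := (grothendieck Bun).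
Local Notation P f := (lens_span f).
Local Notation X := (Bundle I : G).
Local Notation x := (any_dynamics (exposing_system u)).

Definition update_map : hom X (section_functor T S) :=
  @BundleMap C Bun X (Bundle (T S)) (idm S) (iso_to (pull_id Bun (T S)) ∘ u).

Lemma update_map_comp (S' : C) (φ : hom S S') :
  fmap (section_functor T) φ ∘ update_map
    = @BundleMap C Bun X (section_functor T S') φ (sec_mor T φ ∘ u).
Proof. exact: (@vertical_comp_r C Bun (section_functor T S)). Qed.

(** The readout of [x] is an identity, so the exchange involves a unit comparison, which cancels
    against [pull_id]. What remains is the fibre component of the left leg after the lift of [g]
    over [φ]. *)
Lemma exposing_put (Y : bundle Bun) (y : system T Y) (g : bundle_map X Y)
    (φ : hom S (state y))
    (e : bm_base g ∘ lens_get (dynamics x) = lens_get (dynamics y) ∘ φ)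
    (e1 : lens_get (dynamics y) ∘ φ = bm_base g) :
  fmap (pull Bun φ) (lens_put (dynamics y)) ∘ exchange e (fibre Y)
      ∘ fmap (pull Bun (idm S)) (bm_fib g) ∘ iso_to (pull_id Bun I)
    = fmap (pull Bun φ) (lens_put (dynamics y))
        ∘ (iso_from (pull2 e1 (fibre Y)) ∘ bm_fib g).
Proof.
rewrite exchE (exch_pull2 (f1 := idm S) e (comp_idr (bm_base g)) e1).
rewrite -!fib_assoc -pull_id_natural -pull0E; congr (_ ∘ (_ ∘ _)).
by rewrite fib_assoc pull2_unitr comp_idl.
Qed.

Lemma update_map_base (Y : G) (y : system T Y) (φ : hom S (state y))
    (q : hom X (apex (P (dynamics y)))) :
  span_l (P (dynamics y)) ∘ q = fmap (section_functor T) φ ∘ update_map ->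
  bm_base q = φ.
Proof. by move=> e; rewrite -(span_l_base q) e; apply: comp_idr. Qed.

(** Take [q] to be the lift of [g] over [φ]: it exists by the base equation of the covariance
    square, and its left-leg condition is the fibre equation. *)
Lemma exposing_covariantP (Y : G) (y : system T Y) (g : hom X Y)
    (φ : hom S (state y)) :
  covariant (x := x) g φ <->
  exists q : hom X (apex (P (dynamics y))),
    span_r (P (dynamics y)) ∘ q = g /\
    span_l (P (dynamics y)) ∘ q = fmap (section_functor T) φ ∘ update_map.
Proof.
have lE (q : hom X (apex (P (dynamics y)))) :
    span_l (P (dynamics y)) ∘ q
      = @BundleMap C Bun X (section_functor T (state y)) (bm_base q)
          (fmap (pull Bun (bm_base q)) (lens_put (dynamics y)) ∘ bm_fib q).
  exact: vertical_comp_l.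
split.
- case=> e /= e'.
  have e1 : lens_get (dynamics y) ∘ φ = bm_base g by rewrite -e /= comp_idr.
  exists (@cartesian_lift _ _ _ _ X (dynamics y) g φ e1).
  split; first exact: (@cartesian_liftK _ _ _ _ X (dynamics y)).
  apply: eq_trans (lE _) _; apply: eq_trans (eq_sym (update_map_comp φ)).
  rewrite /=; congr BundleMap.
  by rewrite -(exposing_put e) -e' !fib_assoc iso_fromK_r.
- case=> q [er el].
  have ek : bm_base q = φ := update_map_base el.
  have e1 : lens_get (dynamics y) ∘ φ = bm_base g by rewrite -er span_r_base ek.
  have e : bm_base g ∘ idm S = lens_get (dynamics y) ∘ φ by rewrite comp_idr.
  (* A [q] over [φ] with right leg [g] can only be the lift used in the other direction. *)
  have eq : q = @cartesian_lift _ _ _ _ X (dynamics y) g φ e1.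
    apply: cartesian_ext => //; rewrite er.
    by apply: eq_sym; apply: (@cartesian_liftK _ _ _ _ X (dynamics y)).
  exists e; move: (eq_trans el (update_map_comp φ)).
  rewrite eq => /(eq_trans (eq_sym (lE _))) /bundle_map_fib_inj /=.
  rewrite -(exposing_put e) => e'.
  (* Precomposing with the invertible [pull_id] removes the transport of [u] built into
     [exposing_system]. *)
  apply: (@iso_to_inj_r _ _ _ _ (pull_id Bun I)).
  by rewrite e' !fib_assoc iso_fromK_r.
Qed.

Section Lens.
Variables (Y Z : G) (v : lens Y Z) (y : system T Y) (φ : hom S (state y)).
Variables (q : hom X (apex (P v))).

(** A witness [p] for the hypothesis agrees with [q] over [Y], so the two pair to a map into the
    apex of the composite lens. *)
Lemma exposing_covariant_r :
  covariant (x := x) (span_l (P v) ∘ q) φ ->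
  covariant (x := x) (y := system_comp v y) (span_r (P v) ∘ q) φ.
Proof.
move=> /exposing_covariantP [p [pr pl]]; apply/exposing_covariantP.
exists (lens_comp_pair pr); case: (lens_comp_pairE pr) => e1 e2; split.
- exact: cartesian_liftK.
- apply: eq_trans pl; rewrite -[in RHS]e1 comp_assoc.
  by rewrite -lens_comp_fst_l.
Qed.

(** A witness for the composite splits into two components; the condition on the base of [q]
    identifies the second with [q], and the first is then a witness for [y]. *)
Lemma exposing_covariant_l :
  bm_base q = lens_get (dynamics y) ∘ φ ->
  covariant (x := x) (y := system_comp v y) (span_r (P v) ∘ q) φ ->
  covariant (x := x) (span_l (P v) ∘ q) φ.
Proof.
move=> eq /exposing_covariantP [n [nr nl]]; apply/exposing_covariantP.
have en : lens_comp_snd v (dynamics y) ∘ n = q.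
  apply: cartesian_ext; last by rewrite comp_assoc lens_comp_snd_r.
  by rewrite bm_base_comp (update_map_base nl).
exists (lens_comp_fst v (dynamics y) ∘ n); split.
- by rewrite comp_assoc lens_comp_square -comp_assoc en.
- by rewrite comp_assoc lens_comp_fst_l.
Qed.
End Lens.

Lemma hDyn_ext (Y : G) (y : system T Y)
    (m m' : {g : bundle_map X Y & system_over g x y}) :
  projT1 m = projT1 m' -> proj1_sig (projT2 m) = proj1_sig (projT2 m') -> m = m'.
Proof. by case: m m' => [g φ] [g' φ']; apply: system_over_total_eq. Qed.

Lemma hDyn_base (Y : G) (y : system T Y) (m : {g : bundle_map X Y & system_over g x y}) :
  lens_get (dynamics y) ∘ proj1_sig (projT2 m) = bm_base (projT1 m).
Proof.
case: m => g [φ [e ?]] /=; apply: eq_trans (eq_sym e) _; exact: comp_idr.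
Qed.

(** * Vertical comparison isomorphisms: composing with a lens is pulling back along its span *)

Section Component.
Variables (Y Z : G) (v : lens Y Z) (y : system T Y).
Local Notation x' := (exposing_system u).
Local Notation K := (representable_data X).
Local Notation Kv := (@df_ver _ _ K Y Z v).
Local Notation src := (ix_ver SliceSets Kv (@tr_ob _ _ _ _ _ (hDyn_data x') Y y)).
Local Notation tgt := (@tr_ob _ _ _ _ _ (hDyn_data x') Z (system_comp v y)).

Lemma hDyn_ver_covariant (z : slice_dom src) :
  covariant (x := x) (y := system_comp v y) (span_r (P v) ∘ pb2 z)
    (proj1_sig (projT2 (pb1 z))).
Proof.
apply: exposing_covariant_r; rewrite -(pb_eq z : _ = span_l (P v) ∘ pb2 z).
exact: proj2_sig (projT2 (pb1 z)).
Qed.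

Definition hDyn_ver_to : hom src tgt :=
  exist _ (fun z : slice_dom src =>
     (existT _ (span_r (P v) ∘ pb2 z)
        (exist _ (proj1_sig (projT2 (pb1 z))) (hDyn_ver_covariant z)) : slice_dom tgt))
    eq_refl.

Lemma hDyn_lift_base (m : slice_dom tgt) :
  lens_get v ∘ (lens_get (dynamics y) ∘ proj1_sig (projT2 m)) = bm_base (projT1 m).
Proof. by rewrite comp_assoc; apply: (hDyn_base (y := system_comp v y)). Qed.

(** An element of [tgt] does not record a map into the apex of [P v]. It is recovered over the
    readout of [y] along the state map, which is a legitimate base because the representing readout
    is an identity. *)
Definition hDyn_lift (m : slice_dom tgt) : hom X (apex (P v)) :=
  @cartesian_lift C Bun Y Z X v (projT1 m) _ (hDyn_lift_base m).

Lemma hDyn_liftK (m : slice_dom tgt) : span_r (P v) ∘ hDyn_lift m = projT1 m.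
Proof. exact: (@cartesian_liftK C Bun Y Z X v). Qed.

(** The pullback equation and [hDyn_base] show that [pb2 z] has the base used for the lift, so
    cartesian uniqueness applies. *)
Lemma hDyn_lift_to (z : slice_dom src) : hDyn_lift (proj1_sig hDyn_ver_to z) = pb2 z.
Proof.
apply: cartesian_ext; last exact: hDyn_liftK.
rewrite -(span_l_base (pb2 z)) -(pb_eq z : _ = span_l (P v) ∘ pb2 z).
exact: (hDyn_base (pb1 z)).
Qed.

Lemma hDyn_lift_covariant (m : slice_dom tgt) :
  covariant (x := x) (y := y) (span_l (P v) ∘ hDyn_lift m) (proj1_sig (projT2 m)).
Proof.
apply: exposing_covariant_l => //; rewrite hDyn_liftK.
exact: proj2_sig (projT2 m).
Qed.

Definition hDyn_ver_from : hom tgt src :=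
  exist _ (fun m : slice_dom tgt =>
     (@pb _ _ _ (slice_map (@tr_ob _ _ _ _ _ (hDyn_data x') Y y)) (span_l Kv)
       (existT _ (span_l (P v) ∘ hDyn_lift m)
          (exist _ (proj1_sig (projT2 m)) (hDyn_lift_covariant m)))
       (hDyn_lift m) eq_refl : slice_dom src))
   (functional_extensionality _ _ hDyn_liftK).

Definition hDyn_ver : iso src tgt.
Proof.
refine (@Iso _ _ _ hDyn_ver_to hDyn_ver_from _ _).
- apply: slice_eq => z; apply: pb_ext; last exact: hDyn_lift_to.
  apply: hDyn_ext => //.
  apply: eq_trans (eq_sym (pb_eq z)).
  by apply: (f_equal (fun q => span_l (P v) ∘ q)); apply: hDyn_lift_to.
- by apply: slice_eq => m; apply: hDyn_ext => //; apply: hDyn_liftK.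
Defined.
End Component.

(** The vertical comparisons keep state maps, so these compare by the laws of [C]. Bundle maps
    compare by the laws of [grothendieck Bun], by [cartesian_liftK] for comparison squares, or by
    [rep_sq_r] for squares of lenses. *)
Program Definition hDyn_transformation :
    transformation (Dyn T) SliceSets (representable_double X) :=
  @Transformation (Interface Bun) SpanSets (Dyn T) SliceSets (representable_double X)
    (hDyn_data (exposing_system u)) _ _ hDyn_ver _ _ _ _ _ _ _ _.
Next Obligation.
move=> A a; apply: slice_eq => m; apply: hDyn_ext; last exact: comp_idl.
exact: (@comp_idl G).
Qed.
Next Obligation.
move=> A a b c g f; apply: slice_eq => m; apply: hDyn_ext;
  last by apply: eq_sym; apply: comp_assoc.
apply: eq_trans (@comp_idl G _ _ _) _; apply: eq_sym.
by apply: eq_trans (@comp_idl G _ _ _) _; apply: (@comp_idl G).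
Qed.
Next Obligation.
move=> A B v a b f; apply: slice_eq => z; apply: hDyn_ext => //.
by apply: eq_sym; apply: (@comp_idl G).
Qed.
Next Obligation.
move=> A a; apply: slice_over_eq => m; apply: hDyn_ext;
  last by apply: eq_sym; apply: comp_idl.
apply: eq_trans (eq_sym (@comp_idl G _ _ _)).
exact: (cartesian_liftK (f := lens_id _)).
Qed.
Next Obligation.
move=> A B D g f a; apply: slice_over_eq => z; apply: hDyn_ext;
  last by apply: eq_sym; apply: comp_idl.
apply: eq_trans (eq_sym (@comp_idl G _ _ _)).
exact: (cartesian_liftK (f := lens_comp _ _)).
Qed.
Next Obligation.
move=> A B g a' a b f p; apply: slice_over_eq => m; apply: hDyn_ext;
  last by apply: eq_sym; apply: comp_assoc.
by apply: (f_equal (fun n => g ∘ n)); apply: eq_sym; apply: (@comp_idl G).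
Qed.
Next Obligation.
move=> A B g a b b' f p; apply: slice_over_eq => m; apply: hDyn_ext;
  last by apply: eq_sym; apply: comp_assoc.
by apply: eq_sym; apply: (@comp_idl G).
Qed.
Next Obligation.
move=> A a b f; apply: slice_ix_ext => //.
exact: (fmap_id (representable X)).
Qed.
Next Obligation.
move=> A B D g g' a b d p q; apply: slice_ix_ext.
  exact: (fmap_comp (representable X)).
move=> m; apply: hDyn_ext; apply: eq_sym; first exact: (@comp_assoc G).
exact: comp_assoc.
Qed.
Next Obligation.
move=> A B A' B' t b l r s a c p.
apply: slice_over_eq => z; apply: hDyn_ext => //.
exact: rep_sq_r.
Qed.
End Covariance.

Theorem theorem6p2 (C : category) (Bun : indexed_category C)
    (T : bundle_section Bun) (S : C) (I : Bun S) (u : hom I (T S)) :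
  exists F : indexed_double_functor (Dyn T) SliceSets,
    idf_data F =
      {| idf_base_data := representable_data (Bundle I);
         idf_trans_data := hDyn_data (exposing_system u) |}.
Proof. by exists (IndexedDoubleFunctor (hDyn_transformation u)). Qed.
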